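(* Let $t\ge 2$ be an integer and let $L=b(t)$ be the Lie superalgebra of type $b(t)$ over a field $F$ of characteristic zero. Then there exists a polynomial $h=h(n)$ such that for all $n\ge 1$ $$c_n^{gr}(L)\le h(n)\left(t^2-1+t\sqrt{t^2-1}\right)^n.$$ In particular, $$\overline{exp}^{gr}(L)\le t^2-1+t\sqrt{t^2-1}<2t^2-1=\dim L.$$
   Context: $F$ is a field of characteristic zero. A Lie superalgebra is a $\mathbb{Z}_2$-graded algebra $L=L_0\oplus L_1$ over $F$ (elements of $L_0$ are even, $|x|=0$; elements of $L_1$ are odd, $|x|=1$) whose product satisfies $xy-(-1)^{|x||y|}yx$-type super-skew-symmetry and the super Jacobi identity $x(yz)=(xy)z+(-1)^{|x||y|}y(xz)$ for homogeneous $x,y,z$, i.e. the usual definition of a Lie superalgebra. The Lie superalgebra $b(t)$, $t\ge 2$, consists of the $2t\times 2t$ matrices $\begin{pmatrix} A & B\\ C & -A^T\end{pmatrix}$ with $A,B,C\in M_t(F)$, $B^T=B$, $C^T=-C$, $\mathrm{tr}\,A=0$, where $X\mapsto X^T$ is the transpose. Its even part $L_0$ consists of the matrices with $B=C=0$, its odd part $L_1$ of the matrices with $A=0$, and the product is $[x,y]=xy-(-1)^{|x||y|}yx$ for homogeneous $x,y$. Graded codimensions. Let $\mathcal{L}(X,Y)$ be the free Lie superalgebra over $F$ with infinite sets $X$ of even generators and $Y$ of odd generators. A polynomial $f(x_1,\ldots,x_m,y_1,\ldots,y_n)\in\mathcal{L}(X,Y)$ (with $x_i\in X$, $y_j\in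 Y$) is a graded identity of $L=L_0\oplus L_1$ if $f(a_1,\ldots,a_m,b_1,\ldots,b_n)=0$ for all $a_i\in L_0$, $b_j\in L_1$; $Id^{gr}(L)$ is the ideal of all graded identities of $L$. For $0\le k\le n$, $P_{k,n-k}$ is the subspace of multilinear polynomials in $x_1,\ldots,x_k\in X$ and $y_1,\ldots,y_{n-k}\in Y$ in $\mathcal{L}(X,Y)$, and $$P_{k,n-k}(L)=\frac{P_{k,n-k}}{P_{k,n-k}\cap Id^{gr}(L)},\quad c_{k,n-k}(L)=\dim P_{k,n-k}(L),\quad c_n^{gr}(L)=\sum_{k=0}^n\binom{n}{k}c_{k,n-k}(L).$$ The upper graded PI-exponent is $\overline{exp}^{gr}(L)=\limsup_{n\to\infty}\sqrt[n]{c_n^{gr}(L)}$. *)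

(* Defs.v *)
From HB Require Import structures.
From mathcomp Require Import all_boot all_order all_algebra.
From mathcomp Require Import generic_quotient ring.
From mathcomp Require Import all_classical all_reals all_analysis.

Set Implicit Arguments.
Unset Strict Implicit.
Unset Printing Implicit Defensive.

Import Order.TTheory GRing.Theory Num.Theory.

Local Open Scope quotient_scope.
Local Open Scope ring_scope.

(* Degrees are booleans: [false] is even, [true] is odd. Over a field of      *)
(* characteristic 2 or 3 further axioms are customary; only characteristic 0  *)
(* is considered below.                                                       *)
HB.mixin Record isLieSuperalgebra (F : fieldType) L of GRing.Lmodule F L := {
  homog : bool -> {pred L};
  brs : L -> L -> L;
  homog_submod : forall d, submod_closed (homog d);
  homog_sum : forall x, exists x0 x1,
    [/\ x0 \in homog false, x1 \in homog true & x = x0 + x1];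
  homog_direct : forall x, x \in homog false -> x \in homog true -> x = 0;
  brsDl : forall x y z, brs (x + y) z = brs x z + brs y z;
  brsDr : forall x y z, brs x (y + z) = brs x y + brs x z;
  brsZl : forall a x y, brs (a *: x) y = a *: brs x y;
  brsZr : forall a x y, brs x (a *: y) = a *: brs x y;
  brs_homog : forall d e x y, x \in homog d -> y \in homog e ->
    brs x y \in homog (d (+) e);
  brs_skew : forall d e x y, x \in homog d -> y \in homog e ->
    brs x y = - ((-1) ^+ (d && e) *: brs y x);
  brs_jacobi : forall d e f x y z,
    x \in homog d -> y \in homog e -> z \in homog f ->
    brs x (brs y z) = brs (brs x y) z + (-1) ^+ (d && e) *: brs y (brs x z)
}.

#[short(type="lieSuperalgType")]
HB.structure Definition LieSuperalgebra (F : fieldType) :=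
  {L of GRing.Lmodule F L & isLieSuperalgebra F L}.

Section LieSuperTheory.
Variables (F : fieldType) (L : lieSuperalgType F).
Implicit Types x y z : L.

Lemma homog0 d : (0 : L) \in homog d.
Proof. by case: (@homog_submod F L d). Qed.

Lemma homogD d x y : x \in homog d -> y \in homog d -> x + y \in homog d.
Proof.
move=> hx hy; rewrite -[x]scale1r; have [_ hl] := @homog_submod F L d.
exact: hl.
Qed.

Lemma homogZ d a x : x \in homog d -> a *: x \in homog d.
Proof.
move=> hx; rewrite -[_ *: _]addr0; have [h0 hl] := @homog_submod F L d.
exact: hl.
Qed.

Lemma brs0x x : brs 0 x = 0.
Proof. by have := brsZl 0 0 x; rewrite !scale0r. Qed.

Lemma brsx0 x : brs x 0 = 0.
Proof. by have := brsZr 0 x 0; rewrite !scale0r. Qed.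

End LieSuperTheory.

(* The free Lie superalgebra L(X,Y): terms over the generators [fls_var d i]  *)
(* (X for d = false, Y for d = true), modulo the least congruence that        *)
(* imposes the axioms. See [fls_eval] and the lemmas following it for the     *)
(* universal property.                                                        *)
Section FreeTerms.
Variable F : fieldType.

Inductive fls_term : Type :=
| fls_var of bool & nat
| fls_zero
| fls_add of fls_term & fls_term
| fls_scale of F & fls_term
| fls_br of fls_term & fls_term.

Inductive fls_thomog : bool -> fls_term -> Prop :=
| thomog_var d i : fls_thomog d (fls_var d i)
| thomog_zero d : fls_thomog d fls_zero
| thomog_add d s t : fls_thomog d s -> fls_thomog d t ->
    fls_thomog d (fls_add s t)
| thomog_scale d a s : fls_thomog d s -> fls_thomog d (fls_scale a s)
| thomog_br d e s t : fls_thomog d s -> fls_thomog e t ->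
    fls_thomog (d (+) e) (fls_br s t).

Inductive fls_eqv : fls_term -> fls_term -> Prop :=
| eqv_refl s : fls_eqv s s
| eqv_sym s t : fls_eqv s t -> fls_eqv t s
| eqv_trans s t u : fls_eqv s t -> fls_eqv t u -> fls_eqv s u
| eqv_add s s' t t' : fls_eqv s s' -> fls_eqv t t' ->
    fls_eqv (fls_add s t) (fls_add s' t')
| eqv_scale a s s' : fls_eqv s s' -> fls_eqv (fls_scale a s) (fls_scale a s')
| eqv_br s s' t t' : fls_eqv s s' -> fls_eqv t t' ->
    fls_eqv (fls_br s t) (fls_br s' t')
| eqv_addA s t u : fls_eqv (fls_add s (fls_add t u)) (fls_add (fls_add s t) u)
| eqv_addC s t : fls_eqv (fls_add s t) (fls_add t s)
| eqv_add0 s : fls_eqv (fls_add fls_zero s) s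
| eqv_addN s : fls_eqv (fls_add (fls_scale (-1) s) s) fls_zero
| eqv_scaleA a b s : fls_eqv (fls_scale a (fls_scale b s)) (fls_scale (a * b) s)
| eqv_scale1 s : fls_eqv (fls_scale 1 s) s
| eqv_scaleDr a s t :
    fls_eqv (fls_scale a (fls_add s t)) (fls_add (fls_scale a s) (fls_scale a t))
| eqv_scaleDl a b s :
    fls_eqv (fls_scale (a + b) s) (fls_add (fls_scale a s) (fls_scale b s))
| eqv_brDl s t u :
    fls_eqv (fls_br (fls_add s t) u) (fls_add (fls_br s u) (fls_br t u))
| eqv_brDr s t u :
    fls_eqv (fls_br s (fls_add t u)) (fls_add (fls_br s t) (fls_br s u))
| eqv_brZl a s t : fls_eqv (fls_br (fls_scale a s) t) (fls_scale a (fls_br s t))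
| eqv_brZr a s t : fls_eqv (fls_br s (fls_scale a t)) (fls_scale a (fls_br s t))
| eqv_skew d e s t : fls_thomog d s -> fls_thomog e t ->
    fls_eqv (fls_br s t) (fls_scale (- (-1) ^+ (d && e)) (fls_br t s))
| eqv_jacobi d e f s t u :
    fls_thomog d s -> fls_thomog e t -> fls_thomog f u ->
    fls_eqv (fls_br s (fls_br t u))
      (fls_add (fls_br (fls_br s t) u)
               (fls_scale ((-1) ^+ (d && e)) (fls_br t (fls_br s u)))).

HB.instance Definition _ := gen_eqMixin fls_term.
HB.instance Definition _ := gen_choiceMixin fls_term.

Definition fls_rel : rel fls_term := fun s t => `[< fls_eqv s t >].

Lemma fls_rel_equiv : equiv_class_of fls_rel.
Proof.
split=> [s|s t|t s u].
- exact/asboolP/eqv_refl.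
- by apply/asboolP/asboolP; exact: eqv_sym.
- by move=> /asboolP st /asboolP tu; apply/asboolP; exact: eqv_trans st tu.
Qed.

Canonical fls_equiv := EquivRelPack fls_rel_equiv.

Definition free_lie_super := {eq_quot fls_equiv}.

HB.instance Definition _ := Choice.on free_lie_super.
HB.instance Definition _ := Quotient.on free_lie_super.

Local Notation Q := free_lie_super.
Local Notation piQ := (\pi_Q).

Lemma fls_piP s t : fls_eqv s t <-> piQ s = piQ t.
Proof.
split=> [st|]; first by apply/eqmodP/asboolP.
by move/eqmodP/asboolP.
Qed.

Lemma fls_repr_pi s : fls_eqv (repr (piQ s)) s.
Proof. by apply/fls_piP; rewrite reprK. Qed.

Definition fls_qadd (x y : Q) : Q := locked (piQ (fls_add (repr x) (repr y))).
Definition fls_qscale (a : F) (x : Q) : Q := locked (piQ (fls_scale a (repr x))).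
Definition fls_qopp (x : Q) : Q := fls_qscale (-1) x.
Definition fls_qbr (x y : Q) : Q := locked (piQ (fls_br (repr x) (repr y))).
Definition fls_qhomog (d : bool) : {pred Q} :=
  fun x => `[< exists2 t, fls_thomog d t & x = piQ t >].

Lemma pi_add s t : piQ (fls_add s t) = fls_qadd (piQ s) (piQ t).
Proof. by rewrite /fls_qadd -lock; apply/fls_piP/eqv_add; apply/eqv_sym/fls_repr_pi. Qed.

Lemma pi_scale a s : piQ (fls_scale a s) = fls_qscale a (piQ s).
Proof. by rewrite /fls_qscale -lock; apply/fls_piP/eqv_scale; apply/eqv_sym/fls_repr_pi. Qed.

Lemma pi_br s t : piQ (fls_br s t) = fls_qbr (piQ s) (piQ t).
Proof. by rewrite /fls_qbr -lock; apply/fls_piP/eqv_br; apply/eqv_sym/fls_repr_pi. Qed.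

Lemma fls_qaddA : associative fls_qadd.
Proof.
move=> x y z; elim/quotW: x => x; elim/quotW: y => y; elim/quotW: z => z; rewrite -!pi_add.
exact/fls_piP/eqv_addA.
Qed.

Lemma fls_qaddC : commutative fls_qadd.
Proof.
by move=> x y; elim/quotW: x => x; elim/quotW: y => y; rewrite -!pi_add; apply/fls_piP/eqv_addC.
Qed.

Lemma fls_qadd0 : left_id (piQ fls_zero) fls_qadd.
Proof. by move=> x; elim/quotW: x => x; rewrite -!pi_add; apply/fls_piP/eqv_add0. Qed.

Lemma fls_qaddN : left_inverse (piQ fls_zero) fls_qopp fls_qadd.
Proof.
move=> x; elim/quotW: x => x; rewrite /fls_qopp -!pi_scale -!pi_add.
exact/fls_piP/eqv_addN.
Qed.

HB.instance Definition _ :=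
  GRing.isZmodule.Build Q fls_qaddA fls_qaddC fls_qadd0 fls_qaddN.

Lemma fls_piD s t : piQ (fls_add s t) = piQ s + piQ t.
Proof. exact: pi_add. Qed.

Lemma fls_qscaleA a b x : fls_qscale a (fls_qscale b x) = fls_qscale (a * b) x.
Proof. by elim/quotW: x => x; rewrite -!pi_scale; apply/fls_piP/eqv_scaleA. Qed.

Lemma fls_qscale1 : left_id 1 fls_qscale.
Proof. by move=> x; elim/quotW: x => x; rewrite -!pi_scale; apply/fls_piP/eqv_scale1. Qed.

Lemma fls_qscaleDr : right_distributive fls_qscale +%R.
Proof.
move=> a x y; elim/quotW: x => x; elim/quotW: y => y; rewrite -fls_piD -!pi_scale -fls_piD.
exact/fls_piP/eqv_scaleDr.
Qed.

Lemma fls_qscaleDl x : {morph fls_qscale^~ x : a b / a + b}.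
Proof.
move=> a b; elim/quotW: x => x; rewrite -!pi_scale -fls_piD.
exact/fls_piP/eqv_scaleDl.
Qed.

HB.instance Definition _ := GRing.Zmodule_isLmodule.Build F Q
  fls_qscaleA fls_qscale1 fls_qscaleDr fls_qscaleDl.

Lemma fls_piZ a s : piQ (fls_scale a s) = a *: piQ s.
Proof. exact: pi_scale. Qed.

Lemma fls_pi0 : piQ fls_zero = 0.
Proof. by []. Qed.

Lemma fls_qbrDl x y z : fls_qbr (x + y) z = fls_qbr x z + fls_qbr y z.
Proof.
elim/quotW: x => x; elim/quotW: y => y; elim/quotW: z => z; rewrite -fls_piD -!pi_br -fls_piD.
exact/fls_piP/eqv_brDl.
Qed.

Lemma fls_qbrDr x y z : fls_qbr x (y + z) = fls_qbr x y + fls_qbr x z.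
Proof.
elim/quotW: x => x; elim/quotW: y => y; elim/quotW: z => z; rewrite -fls_piD -!pi_br -fls_piD.
exact/fls_piP/eqv_brDr.
Qed.

Lemma fls_qbrZl a x y : fls_qbr (a *: x) y = a *: fls_qbr x y.
Proof.
elim/quotW: x => x; elim/quotW: y => y; rewrite -fls_piZ -!pi_br -fls_piZ.
exact/fls_piP/eqv_brZl.
Qed.

Lemma fls_qbrZr a x y : fls_qbr x (a *: y) = a *: fls_qbr x y.
Proof.
elim/quotW: x => x; elim/quotW: y => y; rewrite -fls_piZ -!pi_br -fls_piZ.
exact/fls_piP/eqv_brZr.
Qed.

Lemma fls_qhomogP d x :
  reflect (exists2 t, fls_thomog d t & x = piQ t) (x \in fls_qhomog d).
Proof. exact: asboolP. Qed.

Lemma fls_qhomog_submod d : submod_closed (fls_qhomog d).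
Proof.
split=> [|a x y /fls_qhomogP[s hs ->] /fls_qhomogP[t ht ->]].
  by apply/fls_qhomogP; exists fls_zero; [exact: thomog_zero|].
rewrite -fls_piZ -fls_piD; apply/fls_qhomogP.
by exists (fls_add (fls_scale a s) t) => //; apply/thomog_add/ht/thomog_scale.
Qed.

Lemma fls_qbr_homog d e x y : x \in fls_qhomog d -> y \in fls_qhomog e ->
  fls_qbr x y \in fls_qhomog (d (+) e).
Proof.
move=> /fls_qhomogP[s hs ->] /fls_qhomogP[t ht ->]; rewrite -pi_br.
by apply/fls_qhomogP; exists (fls_br s t) => //; apply: thomog_br.
Qed.

Lemma fls_qbr_skew d e x y : x \in fls_qhomog d -> y \in fls_qhomog e ->
  fls_qbr x y = - ((-1) ^+ (d && e) *: fls_qbr y x).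
Proof.
move=> /fls_qhomogP[s hs ->] /fls_qhomogP[t ht ->].
by rewrite -!pi_br -scaleNr -fls_piZ; apply/fls_piP/eqv_skew.
Qed.

Lemma fls_qbr_jacobi d e f x y z :
  x \in fls_qhomog d -> y \in fls_qhomog e -> z \in fls_qhomog f ->
  fls_qbr x (fls_qbr y z) =
    fls_qbr (fls_qbr x y) z + (-1) ^+ (d && e) *: fls_qbr y (fls_qbr x z).
Proof.
move=> /fls_qhomogP[s hs ->] /fls_qhomogP[t ht ->] /fls_qhomogP[u hu ->].
by rewrite -!pi_br -fls_piZ -fls_piD; apply/fls_piP/(eqv_jacobi hs ht hu).
Qed.

Fixpoint fls_proj (p : bool) (t : fls_term) : fls_term :=
  match t with
  | fls_var d i => if d == p then fls_var d i else fls_zero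
  | fls_zero => fls_zero
  | fls_add s t => fls_add (fls_proj p s) (fls_proj p t)
  | fls_scale a s => fls_scale a (fls_proj p s)
  | fls_br s t => fls_add (fls_br (fls_proj false s) (fls_proj p t))
                          (fls_br (fls_proj true s) (fls_proj (~~ p) t))
  end.

Lemma fls_proj_homog p t : fls_thomog p (fls_proj p t).
Proof.
elim: t p => [d i||s IHs t IHt|a s IH|s IHs t IHt] p /=.
- by case: eqP => [->|_]; [exact: thomog_var|exact: thomog_zero].
- exact: thomog_zero.
- exact: thomog_add.
- exact: thomog_scale.
- apply: thomog_add; first by have := thomog_br (IHs false) (IHt p).
  by have := thomog_br (IHs true) (IHt (~~ p)); rewrite addTb negbK.
Qed.

Lemma fls_qbr0x x : fls_qbr 0 x = 0.
Proof. by have := fls_qbrZl 0 0 x; rewrite !scale0r. Qed.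

Lemma fls_qbrx0 x : fls_qbr x 0 = 0.
Proof. by have := fls_qbrZr 0 x 0; rewrite !scale0r. Qed.

Lemma fls_proj_sum t : piQ t = piQ (fls_proj false t) + piQ (fls_proj true t).
Proof.
elim: t => [d i||s IHs t IHt|a s IH|s IHs t IHt] /=.
- by case: d => /=; rewrite fls_pi0 ?addr0 ?add0r.
- by rewrite fls_pi0 addr0.
- by rewrite !fls_piD IHs IHt addrACA.
- by rewrite !fls_piZ IH scalerDr.
- rewrite !fls_piD !pi_br {1}IHs {1}IHt !fls_qbrDl !fls_qbrDr.
  by rewrite -!addrA; congr (_ + _); rewrite addrA addrC.
Qed.

Lemma fls_proj_thomog d t p : fls_thomog d t ->
  piQ (fls_proj p t) = if p == d then piQ t else 0.
Proof.
move=> ht; elim: ht p => {d t}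
  [d i|d|d s t _ IHs _ IHt|d a s _ IH|d e s t _ IHs _ IHt] p /=.
- by case: d; case: p.
- by case: eqP.
- by rewrite !fls_piD IHs IHt; case: eqP => //; rewrite addr0.
- by rewrite !fls_piZ IH; case: eqP => //; rewrite scaler0.
- rewrite fls_piD !pi_br !IHs !IHt.
  by case: d e p {IHs IHt} => [] [] [] /=;
    rewrite ?fls_qbr0x ?fls_qbrx0 ?addr0 ?add0r.
Qed.

Lemma fls_proj_eqv p s t : fls_eqv s t ->
  piQ (fls_proj p s) = piQ (fls_proj p t).
Proof.
move=> st; elim: st p => {s t}.
- by [].
- by move=> s t _ IH p; rewrite IH.
- by move=> s t u _ IH1 _ IH2 p; rewrite IH1.
- by move=> s s' t t' _ IH1 _ IH2 p /=; rewrite !fls_piD IH1 IH2.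
- by move=> a s s' _ IH p /=; rewrite !fls_piZ IH.
- by move=> s s' t t' _ IH1 _ IH2 p /=; rewrite !fls_piD !pi_br !IH1 !IH2.
- by move=> s t u p /=; rewrite !fls_piD addrA.
- by move=> s t p /=; rewrite !fls_piD addrC.
- by move=> s p /=; rewrite !fls_piD add0r.
- by move=> s p /=; rewrite !fls_piD !fls_piZ scaleN1r addNr.
- by move=> a b s p /=; rewrite !fls_piZ scalerA.
- by move=> s p /=; rewrite !fls_piZ scale1r.
- by move=> a s t p /=; rewrite !(fls_piZ, fls_piD) scalerDr.
- by move=> a b s p /=; rewrite !(fls_piZ, fls_piD) scalerDl.
- move=> s t u p /=; rewrite !(pi_br, fls_piZ, fls_piD) !fls_qbrDl.
  by rewrite addrACA.
- move=> s t u p /=; rewrite !(pi_br, fls_piZ, fls_piD) !fls_qbrDr.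
  by rewrite addrACA.
- move=> a s t p /=; rewrite !(pi_br, fls_piZ, fls_piD) !fls_qbrZl.
  by rewrite scalerDr.
- move=> a s t p /=; rewrite !(pi_br, fls_piZ, fls_piD) !fls_qbrZr.
  by rewrite scalerDr.
- move=> d e s t hs ht p.
  have h1 := thomog_br hs ht; have h2 := thomog_br ht hs.
  rewrite addbC in h2.
  rewrite (fls_proj_thomog p h1).
  rewrite (fls_proj_thomog p (thomog_scale _ h2)).
  by case: eqP => // _; apply/fls_piP/eqv_skew.
- move=> d e f s t u hs ht hu p.
  have h1 := thomog_br hs (thomog_br ht hu).
  have h2 := thomog_br (thomog_br hs ht) hu.
  have h3 := thomog_br ht (thomog_br hs hu).
  rewrite -addbA in h2; rewrite addbCA in h3.
  rewrite (fls_proj_thomog p h1).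
  rewrite (fls_proj_thomog p (thomog_add h2 (thomog_scale _ h3))).
  by case: eqP => // _; apply/fls_piP/(eqv_jacobi hs ht hu).
Qed.

Lemma fls_qhomog_sum x : exists x0 x1,
  [/\ x0 \in fls_qhomog false, x1 \in fls_qhomog true & x = x0 + x1].
Proof.
exists (piQ (fls_proj false (repr x))), (piQ (fls_proj true (repr x))).
split; last by rewrite -fls_proj_sum reprK.
- by apply/fls_qhomogP; exists (fls_proj false (repr x)); first exact: fls_proj_homog.
- by apply/fls_qhomogP; exists (fls_proj true (repr x)); first exact: fls_proj_homog.
Qed.

Lemma fls_qhomog_direct x :
  x \in fls_qhomog false -> x \in fls_qhomog true -> x = 0.
Proof.
move=> /fls_qhomogP[s hs ->] /fls_qhomogP[t ht st]; rewrite st.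
move/fls_piP/(fls_proj_eqv true): st.
rewrite (fls_proj_thomog _ hs) (fls_proj_thomog _ ht) /= => t0.
by rewrite -t0.
Qed.

HB.instance Definition _ := isLieSuperalgebra.Build F Q
  fls_qhomog_submod fls_qhomog_sum fls_qhomog_direct
  fls_qbrDl fls_qbrDr fls_qbrZl fls_qbrZr
  fls_qbr_homog fls_qbr_skew fls_qbr_jacobi.

Definition fls_gen (d : bool) (i : nat) : Q := piQ (fls_var d i).

Lemma fls_gen_homog d i : fls_gen d i \in homog d.
Proof. by apply/fls_qhomogP; exists (fls_var d i) => //; apply: thomog_var. Qed.

End FreeTerms.

Section Evaluation.
Variables (F : fieldType) (L : lieSuperalgType F).
Local Notation Q := (free_lie_super F).
Implicit Type v : bool -> nat -> L.

Fixpoint fls_teval v (t : fls_term F) : L :=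
  match t with
  | fls_var d i => v d i
  | fls_zero => 0
  | fls_add s t => fls_teval v s + fls_teval v t
  | fls_scale a s => a *: fls_teval v s
  | fls_br s t => brs (fls_teval v s) (fls_teval v t)
  end.

Definition fls_eval v (f : Q) : L := fls_teval v (repr f).

Definition graded_subst v := forall d i, v d i \in homog d.

Lemma fls_teval_homog v d t :
  graded_subst v -> fls_thomog d t -> fls_teval v t \in homog d.
Proof.
move=> hv; elim=> {d t}
  [d i|d|d s t _ IHs _ IHt|d a s _ IH|d e s t _ IHs _ IHt] /=.
- exact: hv.
- exact: homog0.
- exact: homogD.
- exact: homogZ.
- exact: brs_homog.
Qed.

Lemma fls_teval_eqv v s t :
  graded_subst v -> fls_eqv s t -> fls_teval v s = fls_teval v t.
Proof.
move=> hv; elim=> {s t} //=.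
- by move=> s t u _ -> _ ->.
- by move=> s s' t t' _ -> _ ->.
- by move=> a s s' _ ->.
- by move=> s s' t t' _ -> _ ->.
- by move=> s t u; rewrite addrA.
- by move=> s t; rewrite addrC.
- by move=> s; rewrite add0r.
- by move=> s; rewrite scaleN1r addNr.
- by move=> a b s; rewrite scalerA.
- by move=> s; rewrite scale1r.
- by move=> a s t; rewrite scalerDr.
- by move=> a b s; rewrite scalerDl.
- by move=> s t u; rewrite brsDl.
- by move=> s t u; rewrite brsDr.
- by move=> a s t; rewrite brsZl.
- by move=> a s t; rewrite brsZr.
- move=> d e s t /(fls_teval_homog hv) hs /(fls_teval_homog hv) ht.
  by rewrite scaleNr; exact: brs_skew.
- move=> d e f s t u /(fls_teval_homog hv) hs /(fls_teval_homog hv) ht.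
  by move=> /(fls_teval_homog hv) hu; exact: brs_jacobi hs ht hu.
Qed.

Section UniversalProperty.
Variables (v : bool -> nat -> L) (hv : graded_subst v).

Lemma fls_eval_pi t : fls_eval v (\pi_Q t) = fls_teval v t.
Proof. exact/(fls_teval_eqv hv)/fls_repr_pi. Qed.

Lemma fls_eval_gen d i : fls_eval v (fls_gen F d i) = v d i.
Proof. exact: fls_eval_pi. Qed.

Lemma fls_eval_linear : linear (fls_eval v).
Proof.
move=> a x y; rewrite -[x]reprK -[y]reprK -fls_piZ -fls_piD.
by rewrite !fls_eval_pi.
Qed.

Lemma fls_eval_brs (x y : Q) :
  fls_eval v (brs x y) = brs (fls_eval v x) (fls_eval v y).
Proof.
rewrite -[x]reprK -[y]reprK [brs _ _](_ : _ = \pi_Q (fls_br (repr x) (repr y))).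
  by rewrite !fls_eval_pi.
by rewrite pi_br.
Qed.

Lemma fls_eval_homog d (x : Q) : x \in homog d -> fls_eval v x \in homog d.
Proof.
by move=> /fls_qhomogP[t ht ->]; rewrite fls_eval_pi; exact: fls_teval_homog.
Qed.

Lemma fls_eval_unique (f : Q -> L) :
    linear f -> (forall x y : Q, f (brs x y) = brs (f x) (f y)) ->
    (forall d i, f (fls_gen F d i) = v d i) ->
  f =1 fls_eval v.
Proof.
move=> flin fbr fgen x; rewrite -[x]reprK fls_eval_pi.
have f0 : f 0 = 0.
  by have := flin (-1) 0 0; rewrite scaler0 addr0 scaleN1r addNr.
have fD (y z : Q) : f (y + z) = f y + f z.
  by have := flin 1 y z; rewrite !scale1r.
have fZ a (y : Q) : f (a *: y) = a *: f y.
  by have := flin a y 0; rewrite f0 !addr0.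
elim: (repr x) => [d i||s IHs t IHt|a s IH|s IHs t IHt] /=.
- exact: fgen.
- exact: f0.
- by rewrite fls_piD fD IHs IHt.
- by rewrite fls_piZ fZ IH.
- by rewrite pi_br [LHS]fbr IHs IHt.
Qed.

End UniversalProperty.

Definition graded_identity (f : Q) :=
  forall v, graded_subst v -> fls_eval v f = 0.

End Evaluation.

Inductive lie_word : Type :=
| lw_gen of bool & nat
| lw_br of lie_word & lie_word.

Fixpoint lw_letters (w : lie_word) : seq (bool * nat) :=
  match w with
  | lw_gen d i => [:: (d, i)]
  | lw_br u v => lw_letters u ++ lw_letters v
  end.

Fixpoint lw_val (F : fieldType) (w : lie_word) : free_lie_super F :=
  match w with
  | lw_gen d i => fls_gen F d i
  | lw_br u v => brs (lw_val F u) (lw_val F v)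
  end.

(* The variables x_1, ..., x_k, y_1, ..., y_m, numbered from 0. *)
Definition mlin_vars (k m : nat) : seq (bool * nat) :=
  [seq (false, i) | i <- iota 0 k] ++ [seq (true, j) | j <- iota 0 m].

Definition mlin_word (k m : nat) (w : lie_word) : bool :=
  perm_eq (lw_letters w) (mlin_vars k m).

Local Open Scope classical_set_scope.

Definition mlin_space (F : fieldType) (k m : nat) : set (free_lie_super F) :=
  [set f | exists n (a : 'I_n -> F) (w : 'I_n -> lie_word),
     (forall i, mlin_word k m (w i)) /\ f = \sum_(i < n) a i *: lw_val F (w i)].

(* [quot_basis P I v]: for subspaces P and I, the classes of the vectors v i  *)
(* form a basis of P / (P `&` I).                                             *)
Definition quot_basis (F : fieldType) (V : lmodType F) (P I : set V)
    (n : nat) (v : 'I_n -> V) : Prop :=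
  [/\ forall i, P (v i),
      forall a : 'I_n -> F, I (\sum_i a i *: v i) -> forall i, a i = 0 &
      forall x, P x -> exists a : 'I_n -> F, I (x - \sum_i a i *: v i)].

(* The value is 0 if the quotient is infinite-dimensional; [gr_codim2P] below *)
(* shows that this does not occur for codimensions.                           *)
Definition quot_dim (F : fieldType) (V : lmodType F) (P I : set V) : nat :=
  xget 0%N [set n | exists v : 'I_n -> V, quot_basis P I v].

Definition gr_codim2 (F : fieldType) (L : lieSuperalgType F) (k m : nat) : nat :=
  quot_dim (mlin_space k m) [set f | @graded_identity F L f].

Definition gr_codim (F : fieldType) (L : lieSuperalgType F) (n : nat) : nat :=
  (\sum_(k < n.+1) 'C(n, k) * gr_codim2 L k (n - k))%N.

Definition upper_gr_exp (R : realType) (F : fieldType) (L : lieSuperalgType F)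
    : \bar R :=
  limn_esup (fun n => (((gr_codim L n)%:R : R) `^ (n%:R^-1))%:E).

Section QuotDim.
Variables (F : fieldType) (V : lmodType F) (P I : set V).
Hypothesis I0 : I 0.
Hypothesis IL : forall a x y, I x -> I y -> I (a *: x + y).

Let ID x y : I x -> I y -> I (x + y).
Proof. by move=> hx hy; rewrite -[x]scale1r; apply: IL. Qed.
Let IZ a x : I x -> I (a *: x).
Proof. by move=> hx; rewrite -[_ *: _]addr0; apply: IL. Qed.
Let IN x : I x -> I (- x).
Proof. by rewrite -scaleN1r; apply: IZ. Qed.
Let IB x y : I x -> I y -> I (x - y).
Proof. by move=> hx hy; apply/ID/IN. Qed.
Let Isum n (f : 'I_n -> V) : (forall i, I (f i)) -> I (\sum_i f i).
Proof. by move=> hf; apply: big_ind. Qed.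

Lemma quot_basis_leq m n (v : 'I_m -> V) (w : 'I_n -> V) :
  quot_basis P I v -> quot_basis P I w -> (m <= n)%N.
Proof.
move=> [vP vf vs] [wP wf ws].
have /choice[A hA] i := ws _ (vP i).
have /choice[B hB] j := vs _ (wP j).
pose MA : 'M[F]_(m, n) := \matrix_(i, j) A i j.
pose MB : 'M[F]_(n, m) := \matrix_(j, i) B j i.
suff AB : MA *m MB = 1%:M by exact: mulmx1_min AB.
apply/matrixP => i k; apply/esym/eqP; rewrite -subr_eq0; apply/eqP.
pose c l := (1%:M - MA *m MB) i l.
suff /vf/(_ k) : I (\sum_l c l *: v l) by rewrite /c !mxE.
have -> : \sum_l c l *: v l = (v i - \sum_j A i j *: w j)
     + \sum_j A i j *: (w j - \sum_l B j l *: v l).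
  transitivity (v i - \sum_l (MA *m MB) i l *: v l).
    under eq_bigr do rewrite /c mxE [X in _ + X]mxE scalerBl.
    rewrite sumrB; congr (_ - _).
    rewrite (bigD1 i) //= mxE eqxx scale1r big1 ?addr0 // => l /negPf li.
    by rewrite mxE eq_sym li scale0r.
  rewrite -addrA; congr (_ + _).
  under [X in _ = _ + X]eq_bigr do rewrite scalerBr.
  rewrite sumrB addKr; congr (- _).
  under eq_bigr do rewrite mxE scaler_suml.
  rewrite exchange_big; apply: eq_bigr => j _.
  rewrite scaler_sumr; apply: eq_bigr => l _.
  by rewrite !mxE scalerA.
by apply: ID => //; apply: Isum => j; apply/IZ/hB.
Qed.

Lemma quot_basis_dim n (v : 'I_n -> V) : quot_basis P I v -> quot_dim P I = n.
Proof.
move=> hv; rewrite /quot_dim; case: xgetP => [m _ [w hw]|/(_ n)[]]; last by exists v.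
by apply/eqP; rewrite eqn_leq (quot_basis_leq hw hv) (quot_basis_leq hv hw).
Qed.

Lemma quot_basis_exists (s : seq V) :
    (forall x, x \in s -> P x) ->
    (forall x, P x -> exists a : 'I_(size s) -> F, x = \sum_i a i *: s`_i) ->
  exists v : 'I_(quot_dim P I) -> V, quot_basis P I v.
Proof.
move=> sP Ps; suff [n [v hv]] : exists n, exists v : 'I_n -> V, quot_basis P I v.
  by rewrite (quot_basis_dim hv); exists v.
suff [n [v [vP vf vs]]] : exists n, exists v : 'I_n -> V,
    [/\ forall i, P (v i),
        forall a : 'I_n -> F, I (\sum_i a i *: v i) -> forall i, a i = 0 &
        forall x, x \in s -> exists a : 'I_n -> F, I (x - \sum_i a i *: v i)].
  exists n, v; split=> // x /Ps[a ->].
  have /choice[c hc] (i : 'I_(size s)) := vs _ (mem_nth 0 (ltn_ord i)).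
  exists (fun j => \sum_i a i * c i j).
  have -> : \sum_i a i *: s`_i - \sum_j (\sum_i a i * c i j) *: v j
          = \sum_i a i *: (s`_i - \sum_j c i j *: v j).
    under [RHS]eq_bigr do rewrite scalerBr.
    rewrite sumrB; congr (_ - _).
    under eq_bigr do rewrite scaler_suml.
    rewrite exchange_big; apply: eq_bigr => i _.
    by rewrite scaler_sumr; apply: eq_bigr => j _; rewrite scalerA.
  by apply: Isum => i; exact: IZ.
elim: s sP {Ps} => [_|x s IH sP].
  by exists 0%N, (fun=> 0); split=> [[]//|? _ []//|//].
have [|n [v [vP vf vs]]] := IH; first by move=> y ys; apply: sP; rewrite inE ys orbT.
have [[a ha]|nx] := pselect (exists a : 'I_n -> F, I (x - \sum_i a i *: v i)).
  exists n, v; split=> // y; rewrite inE => /predU1P[->|/vs//].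
  by exists a.
exists n.+1, (fun i => if unlift ord0 i is Some j then v j else x).
have sumE (a : 'I_n.+1 -> F) :
    \sum_(i < n.+1) a i *: (if unlift ord0 i is Some j then v j else x)
    = a ord0 *: x + \sum_(i < n) a (lift ord0 i) *: v i.
  rewrite big_ord_recl unlift_none; congr (_ + _).
  by apply: eq_bigr => i _; rewrite liftK.
split.
- by move=> i; case: unliftP => [j _|_] //; apply: sP; rewrite inE eqxx.
- move=> a; rewrite sumE => ha.
  have a0 : a ord0 = 0.
    apply/eqP; apply: contra_notT nx => a0.
    exists (fun i => - (a ord0)^-1 * a (lift ord0 i)).
    have := IZ (a ord0)^-1 ha; rewrite scalerDr scalerA mulVf // scale1r.
    congr (I (_ + _)); rewrite scaler_sumr -sumrN.
    by apply: eq_bigr => i _; rewrite scalerA mulNr scaleNr opprK.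
  rewrite a0 scale0r add0r in ha.
  by move=> i; case: (unliftP ord0 i) => [j|] -> //; exact: (vf _ ha).
- move=> y; rewrite inE => /predU1P[->|/vs[a ha]].
    exists (fun i => (i == ord0)%:R).
    by rewrite sumE /= scale1r big1 ?addr0 ?subrr // => i _; rewrite scale0r.
  exists (fun i => if unlift ord0 i is Some j then a j else 0).
  rewrite sumE unlift_none scale0r add0r.
  by under eq_bigr do rewrite liftK.
Qed.

End QuotDim.

Section CodimFinite.
Variables (F : fieldType) (L : lieSuperalgType F) (k m : nat).

HB.instance Definition _ := gen_eqMixin lie_word.
HB.instance Definition _ := gen_choiceMixin lie_word.

Fixpoint lw_upto (s : seq (bool * nat)) (n : nat) : seq lie_word :=
  [seq lw_gen p.1 p.2 | p <- s] ++
  (if n is n'.+1 then [seq lw_br u v | u <- lw_upto s n', v <- lw_upto s n']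
   else [::]).

Lemma mem_lw_upto s n w : (size (lw_letters w) <= n.+1)%N ->
  {subset lw_letters w <= s} -> w \in lw_upto s n.
Proof.
have lw_gt0 u : (0 < size (lw_letters u))%N.
  by elim: u => //= u IHu v _; rewrite size_cat addn_gt0 IHu.
have gen_in d i n' : (d, i) \in s -> lw_gen d i \in lw_upto s n'.
  by move=> h; case: n' => [|n'] /=; rewrite mem_cat;
     apply/orP; left; apply/mapP; exists (d, i).
elim: n w => [|n IH] [d i|u v].
- by move=> _ h; apply: gen_in; apply: h; rewrite inE.
- rewrite /= size_cat => h; have := leq_trans (leq_add (lw_gt0 u) (lw_gt0 v)) h.
  by [].
- by move=> _ h; apply: gen_in; apply: h; rewrite inE.
- rewrite /= size_cat => h hs; rewrite mem_cat; apply/orP; right.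
  apply/allpairsP; exists (u, v); split=> //=; apply: IH.
  + by rewrite -ltnS; apply: leq_trans h; rewrite -addn1 leq_add2l.
  + by move=> p hp; apply: hs; rewrite mem_cat hp.
  + by rewrite -ltnS; apply: leq_trans h; rewrite -add1n leq_add2r.
  + by move=> p hp; apply: hs; rewrite mem_cat hp orbT.
Qed.

Definition mlin_words : seq lie_word :=
  [seq w <- lw_upto (mlin_vars k m) (k + m) | mlin_word k m w].

Lemma mem_mlin_words w : (w \in mlin_words) = mlin_word k m w.
Proof.
rewrite mem_filter andb_idr // => hw; apply: mem_lw_upto.
  by rewrite (perm_size hw) size_cat !size_map !size_iota leqnSn.
by move=> p; rewrite (perm_mem hw).
Qed.

Lemma graded_identity_submod (a : F) (f g : free_lie_super F) :
  graded_identity L f -> graded_identity L g -> graded_identity L (a *: f + g).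
Proof.
by move=> hf hg v hv; rewrite fls_eval_linear // hf // hg // scaler0 addr0.
Qed.

Lemma graded_identity0 : graded_identity L (0 : free_lie_super F).
Proof. by move=> v hv; rewrite -(fls_pi0 F) fls_eval_pi. Qed.

Lemma gr_codim2P : exists v : 'I_(gr_codim2 L k m) -> free_lie_super F,
  quot_basis (mlin_space k m) [set f | graded_identity L f] v.
Proof.
pose s := [seq lw_val F w | w <- mlin_words].
apply: (@quot_basis_exists _ _ _ _ graded_identity0 graded_identity_submod s).
  move=> x /mapP[w]; rewrite mem_mlin_words => hw ->.
  exists 1%N, (fun=> 1), (fun=> w); split=> //.
  by rewrite big_ord1 scale1r.
move=> x [n [a [w [hw ->]]]].
have hi i : (index (w i) mlin_words < size s)%N.
  by rewrite size_map index_mem mem_mlin_words.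
exists (fun j => \sum_(i | Ordinal (hi i) == j) a i).
under [RHS]eq_bigr do rewrite scaler_suml.
rewrite (exchange_big_dep xpredT) //=; apply: eq_bigr => i _.
rewrite (big_pred1 (Ordinal (hi i))) => [|j]; last by rewrite /= eq_sym.
rewrite /= (nth_map (w i)); last by rewrite index_mem mem_mlin_words.
by rewrite nth_index ?mem_mlin_words.
Qed.

End CodimFinite.

Section BSpace.
Variables (F : fieldType) (t : nat).
Local Notation M2 := 'M[F]_(t + t).

Definition b_diag (M : M2) : 'M[F]_t := drsubmx M + (ulsubmx M)^T.
Definition b_sym (M : M2) : 'M[F]_t := ursubmx M - (ursubmx M)^T.
Definition b_skew (M : M2) : 'M[F]_t := dlsubmx M + (dlsubmx M)^T.
Definition b_trace (M : M2) : F^o := \tr (ulsubmx M).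

Fact b_diag_linear : linear b_diag.
Proof. by move=> a M N; apply/matrixP => i j; rewrite !mxE; ring. Qed.
Fact b_sym_linear : linear b_sym.
Proof. by move=> a M N; apply/matrixP => i j; rewrite !mxE; ring. Qed.
Fact b_skew_linear : linear b_skew.
Proof. by move=> a M N; apply/matrixP => i j; rewrite !mxE; ring. Qed.
Fact b_trace_linear : linear b_trace.
Proof.
move=> a M N; rewrite /b_trace /mxtrace scaler_sumr -big_split.
by apply: eq_bigr => i _; rewrite !mxE.
Qed.

HB.instance Definition _ := GRing.isLinear.Build F M2 'M[F]_t *:%R b_diag b_diag_linear.
HB.instance Definition _ := GRing.isLinear.Build F M2 'M[F]_t *:%R b_sym b_sym_linear.
HB.instance Definition _ := GRing.isLinear.Build F M2 'M[F]_t *:%R b_skew b_skew_linear.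
HB.instance Definition _ := GRing.isLinear.Build F M2 F^o *:%R b_trace b_trace_linear.

Definition b_space : {vspace 'M[F]_(t + t)} :=
  (lker (linfun b_diag) :&: lker (linfun b_sym) :&:
   lker (linfun b_skew) :&: lker (linfun b_trace))%VS.

Lemma b_spaceP (M : M2) :
  reflect (exists A B C : 'M[F]_t,
             [/\ B^T = B, C^T = - C, \tr A = 0 & M = block_mx A B C (- A^T)])
          (M \in b_space).
Proof.
rewrite !memv_cap !memv_ker !lfunE /=; apply: (iffP idP).
  move=> /andP[/andP[/andP[/eqP h1 /eqP h2] /eqP h3] /eqP h4].
  exists (ulsubmx M), (ursubmx M), (dlsubmx M); split=> //.
  - by apply/esym/subr0_eq.
  - by apply/eqP; rewrite -addr_eq0 addrC; apply/eqP.
  - by rewrite -[in LHS](submxK M); congr block_mx; apply/eqP; rewrite -addr_eq0; apply/eqP.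
move=> [A [B [C [hB hC hA ->]]]].
rewrite /b_diag /b_sym /b_skew /b_trace.
rewrite block_mxKdr block_mxKul block_mxKur block_mxKdl.
by rewrite hB hC hA addNr !subrr !eqxx.
Qed.

Definition mx_part (d : bool) (M : M2) : M2 :=
  if d then block_mx 0 (ursubmx M) (dlsubmx M) 0
  else block_mx (ulsubmx M) 0 0 (drsubmx M).

Definition mx_brs (M N : M2) : M2 :=
  \sum_(d : bool) \sum_(e : bool)
    (mx_part d M *m mx_part e N - (-1) ^+ (d && e) *: (mx_part e N *m mx_part d M)).

Lemma mx_part_linear d : linear (mx_part d).
Proof.
move=> a M N; rewrite /mx_part; case: d; rewrite scale_block_mx add_block_mx
  !scaler0 !addr0; congr block_mx; by apply/matrixP => i j; rewrite !mxE.
Qed.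

Lemma mx_part_sum M : M = mx_part false M + mx_part true M.
Proof. by rewrite add_block_mx !addr0 !add0r submxK. Qed.

Lemma mx_part_id d e M : mx_part e (mx_part d M) = if d == e then mx_part d M else 0.
Proof.
by case: d e => [] [];
  rewrite /mx_part ?block_mxKul ?block_mxKur ?block_mxKdl ?block_mxKdr //= -block_mx0.
Qed.

Lemma mx_brs_linearl N : linear (mx_brs^~ N).
Proof.
move=> a M M'; rewrite /mx_brs scaler_sumr -big_split; apply: eq_bigr => d _.
rewrite scaler_sumr -big_split; apply: eq_bigr => e _ /=.
rewrite mx_part_linear !(mulmxDl, mulmxDr) -!(scalemxAl, scalemxAr).
by apply/matrixP => i j; rewrite !mxE; ring.
Qed.

Lemma mx_brs_linearr M : linear (mx_brs M).
Proof.
move=> a N N'; rewrite /mx_brs scaler_sumr -big_split; apply: eq_bigr => d _.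
rewrite scaler_sumr -big_split; apply: eq_bigr => e _ /=.
rewrite mx_part_linear !(mulmxDl, mulmxDr) -!(scalemxAl, scalemxAr).
by apply/matrixP => i j; rewrite !mxE; ring.
Qed.

Lemma mx_brs_homog d e M N : mx_part d M = M -> mx_part e N = N ->
  mx_brs M N = M *m N - (-1) ^+ (d && e) *: (N *m M).
Proof.
move=> hM hN; rewrite /mx_brs (bigD1 d) //= (bigD1 e) //= hM hN.
rewrite [X in _ + X + _]big1 => [|e' /negPf ne]; last first.
  by rewrite -hN mx_part_id eq_sym ne mulmx0 mul0mx scaler0 subrr.
rewrite [X in _ + X]big1 ?addr0 // => d' /negPf nd; apply: big1 => e' _.
by rewrite -hM mx_part_id eq_sym nd mulmx0 mul0mx scaler0 subrr.
Qed.

Lemma mx_part_mul d e M N : mx_part d M = M -> mx_part e N = N ->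
  mx_part (d (+) e) (M *m N) = M *m N.
Proof.
move=> <- <-; case: d; case: e; rewrite /mx_part /= mulmx_block
  ?(block_mxKul, block_mxKur, block_mxKdl, block_mxKdr)
  !(mul0mx, mulmx0, addr0, add0r) //.
Qed.

Lemma mx_brs_part d e M N : mx_part d M = M -> mx_part e N = N ->
  mx_part (d (+) e) (mx_brs M N) = mx_brs M N.
Proof.
move=> hM hN; rewrite (mx_brs_homog hM hN) -scaleNr addrC.
by rewrite mx_part_linear (mx_part_mul hM hN) addbC (mx_part_mul hN hM).
Qed.

End BSpace.

(* In characteristic 2 the diagonal blocks of an odd-odd bracket need not be  *)
(* traceless, hence the proof of characteristic 0 among the parameters.       *)
Definition lie_super_b (F : fieldType) (F0 : [pchar F] =i pred0) (t : nat) :=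
  subvs_of (b_space F t).

Section BAlgebra.
Variables (F : fieldType) (F0 : [pchar F] =i pred0) (t : nat).

Local Notation b := (lie_super_b F0 t).
HB.instance Definition _ := Vector.on b.

Implicit Types x y z : b.

Lemma mx_brs_b (M N : 'M[F]_(t + t)) :
  M \in b_space F t -> N \in b_space F t -> mx_brs M N \in b_space F t.
Proof.
move=> /b_spaceP[A [B [C [hB hC hA ->]]]] /b_spaceP[A' [B' [C' [hB' hC' hA' ->]]]].
have tr0 (S K : 'M[F]_t) : S^T = S -> K^T = - K -> \tr (S *m K) = 0.
  move=> hS hK; have : \tr (S *m K) *+ 2 = 0.
    rewrite mulr2n -{1}mxtrace_tr trmx_mul hS hK mulNmx raddfN /=.
    by rewrite mxtrace_mulC addNr.
  by move/eqP; rewrite -mulr_natr mulf_eq0 ((pcharf0P F).1 F0) orbF => /eqP.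
have trB (S K : 'M[F]_t) : (S - K)^T = S^T - K^T by apply/matrixP => i j; rewrite !mxE.
have trD (S K : 'M[F]_t) : (S + K)^T = S^T + K^T by apply/matrixP => i j; rewrite !mxE.
apply/b_spaceP.
exists (A *m A' - A' *m A + (B *m C' + B' *m C)),
  (A *m B' + B' *m A^T - (B *m A'^T + A' *m B)),
  (C *m A' + A'^T *m C - (A^T *m C' + C' *m A)).
split.
- rewrite !(trB, trD) !trmx_mul !trmxK hB hB'.
  by apply/matrixP => i j; rewrite !mxE; ring.
- rewrite !(trB, trD) !trmx_mul !trmxK hC hC'.
  rewrite !(mulNmx, mulmxN).
  by apply/matrixP => i j; rewrite !mxE; ring.
- rewrite mxtraceD raddfB /= mxtrace_mulC subrr add0r mxtraceD.
  by rewrite !tr0 ?addr0.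
rewrite /mx_brs !big_bool /mx_part /=.
rewrite !(block_mxKul, block_mxKur, block_mxKdl, block_mxKdr) !mulmx_block.
rewrite !(mul0mx, mulmx0, addr0, add0r) !scale_block_mx !opp_block_mx !add_block_mx.
rewrite !(trB, trD) !trmx_mul hB hB' hC hC'.
rewrite !(mulNmx, mulmxN, expr1, expr0, scaler0).
by congr block_mx; apply/matrixP => i j; rewrite !mxE; ring.
Qed.

Definition b_brs (x y : b) : b := vsproj _ (mx_brs (vsval x) (vsval y)).

Definition b_homog (d : bool) : {pred b} := fun x =>
  if d then ulsubmx (vsval x) == 0
  else (ursubmx (vsval x) == 0) && (dlsubmx (vsval x) == 0).

Lemma b_homogP d x : reflect (mx_part d (vsval x) = vsval x) (x \in b_homog d).
Proof.
apply: (iffP idP); rewrite [_ \in _]/(b_homog d x) /b_homog;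
  have /b_spaceP[A [B [C [_ _ _ hx]]]] := subvsP x; rewrite hx /mx_part
  !(block_mxKul, block_mxKur, block_mxKdl, block_mxKdr); case: d.
- by move=> /eqP ->; rewrite trmx0 oppr0.
- by move=> /andP[/eqP -> /eqP ->].
- by move=> /eq_block_mx[<- _ _ _].
- by move=> /eq_block_mx[_ <- <- _]; rewrite eqxx.
Qed.

Lemma b_brsE x y : vsval (b_brs x y) = mx_brs (vsval x) (vsval y).
Proof. by rewrite vsprojK //; apply: mx_brs_b; apply: subvsP. Qed.

Lemma b_brs_homogE d e x y : x \in b_homog d -> y \in b_homog e ->
  vsval (b_brs x y) =
    vsval x *m vsval y - (-1) ^+ (d && e) *: (vsval y *m vsval x).
Proof. by move=> /b_homogP hx /b_homogP hy; rewrite b_brsE (mx_brs_homog hx hy). Qed.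

Lemma b_brs_linearl y : linear (b_brs^~ y).
Proof.
by move=> a x x'; apply: subvs_inj; rewrite linearP /= !b_brsE linearP mx_brs_linearl.
Qed.

Lemma b_brs_linearr x : linear (b_brs x).
Proof.
by move=> a y y'; apply: subvs_inj; rewrite linearP /= !b_brsE linearP mx_brs_linearr.
Qed.

Lemma b_homog_submod d : submod_closed (b_homog d).
Proof.
split=> [|a x y /b_homogP hx /b_homogP hy]; apply/b_homogP; last first.
  by rewrite linearP mx_part_linear hx hy.
have := mx_part_linear d (-1) (0 : 'M[F]_(t + t)) 0.
by rewrite scaler0 addr0 scaleN1r addNr.
Qed.

Lemma b_mx_part d (x : b) : mx_part d (vsval x) \in b_space F t.
Proof.
have /b_spaceP[A [B [C [hB hC hA ->]]]] := subvsP x; apply/b_spaceP.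
rewrite /mx_part !(block_mxKul, block_mxKur, block_mxKdl, block_mxKdr).
case: d; last by exists A, 0, 0; rewrite !trmx0 oppr0.
by exists 0, B, C; rewrite !trmx0 oppr0 mxtrace0.
Qed.

Lemma b_homog_sum x : exists x0 x1,
  [/\ x0 \in b_homog false, x1 \in b_homog true & x = x0 + x1].
Proof.
exists (vsproj _ (mx_part false (vsval x))), (vsproj _ (mx_part true (vsval x))).
split; try by apply/b_homogP; rewrite !(vsprojK (b_mx_part _ _)) mx_part_id eqxx.
apply: subvs_inj; rewrite linearD [LHS]mx_part_sum.
by congr (_ + _); rewrite -[LHS](vsprojK (b_mx_part _ _)).
Qed.

Lemma b_homog_direct x : x \in b_homog false -> x \in b_homog true -> x = 0.
Proof.
move=> /b_homogP h0 /b_homogP h1; apply: subvs_inj.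
by rewrite linear0 -h0 -h1 mx_part_id.
Qed.

Lemma b_brsDl x y z : b_brs (x + y) z = b_brs x z + b_brs y z.
Proof. by have := b_brs_linearl z 1 x y; rewrite !scale1r. Qed.

Lemma b_brsDr x y z : b_brs x (y + z) = b_brs x y + b_brs x z.
Proof. by have := b_brs_linearr x 1 y z; rewrite !scale1r. Qed.

Lemma b_brs0x y : b_brs 0 y = 0.
Proof. by have := b_brs_linearl y (-1) 0 0; rewrite scaler0 addr0 scaleN1r addNr. Qed.

Lemma b_brsx0 x : b_brs x 0 = 0.
Proof. by have := b_brs_linearr x (-1) 0 0; rewrite scaler0 addr0 scaleN1r addNr. Qed.

Lemma b_brsZl a x y : b_brs (a *: x) y = a *: b_brs x y.
Proof. by have := b_brs_linearl y a x 0; rewrite b_brs0x !addr0. Qed.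

Lemma b_brsZr a x y : b_brs x (a *: y) = a *: b_brs x y.
Proof. by have := b_brs_linearr x a y 0; rewrite b_brsx0 !addr0. Qed.

Lemma b_brs_homog d e x y : x \in b_homog d -> y \in b_homog e ->
  b_brs x y \in b_homog (d (+) e).
Proof.
move=> /b_homogP hx /b_homogP hy; apply/b_homogP.
by rewrite b_brsE (mx_brs_part hx hy).
Qed.

Lemma b_brs_skew d e x y : x \in b_homog d -> y \in b_homog e ->
  b_brs x y = - ((-1) ^+ (d && e) *: b_brs y x).
Proof.
move=> hx hy; apply: subvs_inj.
rewrite linearN linearZ /= (b_brs_homogE hx hy) (b_brs_homogE hy hx).
by rewrite opprB scalerBr scalerA andbC -signr_addb addbb scale1r.
Qed.

Lemma b_brs_jacobi d e f x y z :
  x \in b_homog d -> y \in b_homog e -> z \in b_homog f ->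
  b_brs x (b_brs y z) =
    b_brs (b_brs x y) z + (-1) ^+ (d && e) *: b_brs y (b_brs x z).
Proof.
move=> hx hy hz; apply: subvs_inj; rewrite linearD linearZ /=.
rewrite (b_brs_homogE hx (b_brs_homog hy hz)) (b_brs_homogE hy hz).
rewrite (b_brs_homogE (b_brs_homog hx hy) hz) (b_brs_homogE hx hy).
rewrite (b_brs_homogE hy (b_brs_homog hx hz)) (b_brs_homogE hx hz).
rewrite !(mulmxBl, mulmxBr) -!(scalemxAl, scalemxAr) !mulmxA.
by case: d e f {hx hy hz} => [] [] [];
  apply/matrixP => i j; rewrite !mxE /= ?expr0 ?expr1; ring.
Qed.

HB.instance Definition _ := isLieSuperalgebra.Build F b
  b_homog_submod b_homog_sum b_homog_direct
  b_brsDl b_brsDr b_brsZl b_brsZr b_brs_homog b_brs_skew b_brs_jacobi.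

End BAlgebra.

(* Main.v *)
Require Import Defs.
From HB Require Import structures.
From mathcomp Require Import all_boot all_order all_algebra.
From mathcomp Require Import ring lra zify.
From mathcomp Require Import all_classical all_reals all_analysis.

Set Implicit Arguments.
Unset Strict Implicit.
Unset Printing Implicit Defensive.

Import Order.TTheory GRing.Theory Num.Theory.
Local Open Scope ring_scope.

(* A multilinear polynomial in k even and m odd variables is determined on L  *)
(* by its values at tuples of homogeneous basis elements, so c_{k,m}(L) is at *)
(* most dim L times the number of tuples at which some monomial is nonzero.   *)
(* The algebra b(t) is Z-graded in degrees -1, 0, 1: the blocks B and C have  *)
(* degrees 1 and -1, with p = t(t+1)/2 and q = t(t-1)/2 basis elements. So    *)
(* the numbers of odd arguments of degrees 1 and -1 differ by at most 1 in    *)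
(* such a tuple. Weighting them by sqrt(q/p) and sqrt(p/q) shows that there   *)
(* are at most sqrt(p/q) (2 sqrt(pq))^m admissible odd parts, where           *)
(* 2 sqrt(pq) = t sqrt(t^2-1); the binomial formula then gives the bound with *)
(* a constant polynomial h.                                                   *)

(** Evaluating a multilinear polynomial at all tuples of homogeneous basis elements, coordinate by
    coordinate, is a linear map on [mlin_space k m] whose kernel consists of graded identities
    ([mlin_eval0]). So c_{k,m} is the rank of a matrix with one column for each pair of an argument
    tuple and a coordinate, and tuples at which every monomial vanishes may be dropped
    ([gr_codim2_le]). For b(t), [lw_eval_degree] and [b_degree_large] make every monomial vanish
    unless the odd degrees sum to -1, 0 or 1. This gives [b_codim2_le], with the number of balanced
    odd tuples estimated in [card_balanced] by a generating function. Summing over k is the binomial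
    formula, and [limn_esup_root_le] removes the constant factor in the limit. *)

Section WordEvaluation.
Variables (F : fieldType) (L : lieSuperalgType F).
Implicit Types (v : bool -> nat -> L) (w : lie_word) (p : bool * nat).

Fixpoint lw_eval v w : L :=
  match w with
  | lw_gen d i => v d i
  | lw_br w1 w2 => brs (lw_eval v w1) (lw_eval v w2)
  end.

Fixpoint lw_parity w : bool :=
  match w with
  | lw_gen d _ => d
  | lw_br w1 w2 => lw_parity w1 (+) lw_parity w2
  end.

Definition lw_subst v p (y : L) : bool -> nat -> L :=
  fun d i => if (d, i) == p then y else v d i.

Lemma fls_eval_lw v w : graded_subst v -> fls_eval v (lw_val F w) = lw_eval v w.
Proof.
move=> hv; elim: w => [d i|w1 IH1 w2 IH2] /=; first exact: fls_eval_gen.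
by rewrite fls_eval_brs // IH1 IH2.
Qed.

Lemma lw_eval_homog v w : graded_subst v -> lw_eval v w \in homog (lw_parity w).
Proof. by move=> hv; elim: w => //= w1 h1 w2 h2; apply: brs_homog. Qed.

Lemma eq_lw_eval v v' w :
  {in lw_letters w, forall p, v p.1 p.2 = v' p.1 p.2} ->
  lw_eval v w = lw_eval v' w.
Proof.
elim: w => [d i|w1 IH1 w2 IH2] /= h; first by apply: (h (d, i)); rewrite inE.
rewrite IH1 ?IH2 // => p hp; apply: h; rewrite mem_cat hp ?orbT //.
Qed.

Lemma brs_suml (I : finType) (a : I -> F) (x : I -> L) y :
  brs (\sum_i a i *: x i) y = \sum_i a i *: brs (x i) y.
Proof.
rewrite (big_morph (brs^~ y) (fun x x' => brsDl x x' y) (brs0x y)).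
by apply: eq_bigr => i _; rewrite brsZl.
Qed.

Lemma brs_sumr (I : finType) (a : I -> F) (x : I -> L) y :
  brs y (\sum_i a i *: x i) = \sum_i a i *: brs y (x i).
Proof.
rewrite (big_morph (brs y) (brsDr y) (brsx0 y)).
by apply: eq_bigr => i _; rewrite brsZr.
Qed.

Lemma lw_eval_subst_notin v p y w :
  p \notin lw_letters w -> lw_eval (lw_subst v p y) w = lw_eval v w.
Proof.
move=> hp; apply: eq_lw_eval => -[d i] hdi; rewrite /lw_subst /=.
by case: eqP => // e; rewrite -e hdi in hp.
Qed.

(** A letter that occurs once lies in exactly one factor of each bracket; the other factor does not
    change, and the bracket is bilinear. *)
Lemma lw_eval_subst_sum v p w (I : finType) (a : I -> F) (y : I -> L) :
  count_mem p (lw_letters w) = 1%N ->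
  lw_eval (lw_subst v p (\sum_i a i *: y i)) w =
  \sum_i a i *: lw_eval (lw_subst v p (y i)) w.
Proof.
elim: w => [d i|w1 IH1 w2 IH2] /=.
  by rewrite addn0 /lw_subst; case: eqP.
rewrite count_cat => h.
have [p1|p1] := boolP (p \in lw_letters w1).
  have c1 : count_mem p (lw_letters w1) = 1%N.
    move: p1; rewrite -has_pred1 has_count; case: count h => [//|n].
    by rewrite addSn => -[] /eqP; rewrite addn_eq0 => /andP[/eqP ->].
  have p2 : p \notin lw_letters w2.
    by apply/count_memPn; move: h; rewrite c1 add1n => -[].
  rewrite IH1 // brs_suml; apply: eq_bigr => i _.
  by rewrite !(lw_eval_subst_notin _ _ p2).
move/count_memPn: (p1) h => ->; rewrite add0n => h.
rewrite IH2 // brs_sumr; apply: eq_bigr => i _.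
by rewrite !(lw_eval_subst_notin _ _ p1).
Qed.

Lemma lw_subst_graded v p y :
  graded_subst v -> y \in homog p.1 -> graded_subst (lw_subst v p y).
Proof. by move=> hv hy d i; rewrite /lw_subst; case: eqP => // e; rewrite -e in hy. Qed.

End WordEvaluation.

Lemma fls_eval_sum (F : fieldType) (L : lieSuperalgType F) (u : bool -> nat -> L)
    n (a : 'I_n -> F) (f : 'I_n -> free_lie_super F) : graded_subst u ->
  fls_eval u (\sum_i a i *: f i) = \sum_i a i *: fls_eval u (f i).
Proof.
move=> hu; have hl := fls_eval_linear hu.
have e0 : fls_eval u 0 = 0 by exact: fls_eval_pi hu (fls_zero F).
have eD x y : fls_eval u (x + y) = fls_eval u x + fls_eval u y.
  by have := hl 1 x y; rewrite !scale1r.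
rewrite (big_morph (fls_eval u) eD e0); apply: eq_bigr => i _.
by have := hl (a i) (f i) 0; rewrite e0 !addr0.
Qed.

Lemma mlin_space_sum (F : fieldType) k m n (a : 'I_n -> F)
    (v : 'I_n -> free_lie_super F) :
  (forall i, mlin_space k m (v i)) -> mlin_space k m (\sum_i a i *: v i).
Proof.
move=> hv; apply: (big_ind (@mlin_space F k m)).
- by exists 0%N, (fun=> 0), (fun=> lw_gen false 0); split; [case|rewrite big_ord0].
- move=> _ _ [n1 [a1 [w1 [h1 ->]]]] [n2 [a2 [w2 [h2 ->]]]].
  exists (n1 + n2)%N,
    (fun i : 'I_(n1 + n2) =>
       match fintype.split i with inl j => a1 j | inr j => a2 j end),
    (fun i : 'I_(n1 + n2) =>
       match fintype.split i with inl j => w1 j | inr j => w2 j end); split.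
    by move=> i; case: fintype.split.
  rewrite big_split_ord /=; congr (_ + _); apply: eq_bigr => i _.
    by rewrite -[lshift _ _]/(unsplit (inl i)) unsplitK.
  by rewrite -[rshift _ _]/(unsplit (inr i)) unsplitK.
- move=> i _; have [N [b [w [hw ->]]]] := hv i.
  exists N, (fun l => a i * b l), w; split=> //; rewrite scaler_sumr.
  by apply: eq_bigr => l _; rewrite scalerA.
Qed.

(** * Codimension bound by counting tuples of basis elements *)

Section MultilinearCodimension.
Variables (F : fieldType) (L : lieSuperalgType F) (k m : nat).
Variables (E0 E1 : finType) (e0 : E0 -> L) (e1 : E1 -> L).
Hypothesis e0_homog : forall i, e0 i \in homog false.
Hypothesis e1_homog : forall i, e1 i \in homog true.
Hypothesis e0_span :
  forall x : L, x \in homog false -> exists a : E0 -> F, x = \sum_i a i *: e0 i.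
Hypothesis e1_span :
  forall x : L, x \in homog true -> exists a : E1 -> F, x = \sum_i a i *: e1 i.

Local Notation tuples := ({ffun 'I_k -> E0} * {ffun 'I_m -> E1})%type.

(** Variables out of range are sent to 0, which is homogeneous of both degrees, so the substitution
    stays graded. *)
Definition tuple_subst (x : tuples) (d : bool) (i : nat) : L :=
  if d then oapp (fun j => e1 (x.2 j)) 0 (insub i)
  else oapp (fun j => e0 (x.1 j)) 0 (insub i).

Lemma tuple_subst_graded x : graded_subst (tuple_subst x).
Proof. by move=> [] i; rewrite /tuple_subst; case: insub => [j|] //=; apply: homog0. Qed.

Lemma mlin_letters_uniq w : mlin_word k m w -> uniq (lw_letters w).
Proof.
move=> /perm_uniq ->; rewrite cat_uniq !map_inj_uniq ?iota_uniq ?andbT /=.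
- by apply/hasPn => _ /mapP[j _ ->]; apply/mapP => -[].
- by move=> i j [].
- by move=> i j [].
Qed.

Definition on_basis (d : bool) (y : L) :=
  if d then exists i, y = e1 i else exists i, y = e0 i.

(** Multilinearity: the variables are expanded in the basis one at a time, until only tuples of
    basis elements remain. *)
Lemma mlin_eval0 n (a : 'I_n -> F) (w : 'I_n -> lie_word) (v : bool -> nat -> L) :
    (forall l, mlin_word k m (w l)) ->
    (forall x, \sum_l a l *: lw_eval (tuple_subst x) (w l) = 0) ->
  graded_subst v -> \sum_l a l *: lw_eval v (w l) = 0.
Proof.
move=> hw h0 hv.
(* The list [s] holds the variables whose values need not be basis elements yet; the induction
   removes them one by one. *)
suff step (s : seq (bool * nat)) v' : {subset s <= mlin_vars k m} ->
    graded_subst v' ->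
    (forall p, p \in mlin_vars k m -> p \notin s -> on_basis p.1 (v' p.1 p.2)) ->
    \sum_l a l *: lw_eval v' (w l) = 0.
  by apply: (step (mlin_vars k m)) => // p ->.
elim: s v' => [|p s IH] v' hs hv' hb.
  (* With [s] empty, [v'] agrees with some [tuple_subst] on all letters of the words. *)
  have hb0 (i : 'I_k) : exists x, v' false i = e0 x.
    apply: (hb (false, val i)) => //; rewrite mem_cat map_f //.
    by rewrite mem_iota /= add0n.
  have hb1 (i : 'I_m) : exists x, v' true i = e1 x.
    apply: (hb (true, val i)) => //; rewrite mem_cat orbC map_f //.
    by rewrite mem_iota /= add0n.
  have [f hf] := choice hb0; have [g hg] := choice hb1.
  rewrite -[RHS](h0 (finfun f, finfun g)); apply: eq_bigr => l _; congr (_ *: _).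
  apply: eq_lw_eval => -[d i]; rewrite (perm_mem (hw l)) mem_cat /tuple_subst /=.
  case/orP => /mapP[j]; rewrite mem_iota add0n => /= hj [-> ->].
    by rewrite (insubT (fun j => (j < k)%N) hj) /= ffunE -hf.
  by rewrite (insubT (fun j => (j < m)%N) hj) /= ffunE -hg.
have pin : p \in mlin_vars k m by apply: hs; rewrite inE eqxx.
have count1 l : count_mem p (lw_letters (w l)) = 1%N.
  by rewrite count_uniq_mem ?mlin_letters_uniq // (perm_mem (hw l)) pin.
have [I [b [z [zb zh vE]]]] : exists (I : finType) (b : I -> F) (z : I -> L),
    [/\ forall i, on_basis p.1 (z i), forall i, z i \in homog p.1
      & v' p.1 p.2 = \sum_i b i *: z i].
  have := hv' p.1 p.2; rewrite /on_basis; case: (p.1) => hp.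
    have [b hb'] := e1_span hp; exists E1, b, e1; split=> // i; by exists i.
  have [b hb'] := e0_span hp; exists E0, b, e0; split=> // i; by exists i.
have -> : \sum_l a l *: lw_eval v' (w l) =
    \sum_i b i *: \sum_l a l *: lw_eval (lw_subst v' p (z i)) (w l).
  under [RHS]eq_bigr do rewrite scaler_sumr.
  rewrite exchange_big; apply: eq_bigr => l _.
  have -> : lw_eval v' (w l) = lw_eval (lw_subst v' p (\sum_i b i *: z i)) (w l).
    apply: eq_lw_eval => -[d i] _; rewrite /lw_subst /=.
    by case: eqP => // e; rewrite -vE -e.
  rewrite lw_eval_subst_sum // scaler_sumr; apply: eq_bigr => i _.
  by rewrite !scalerA mulrC.
rewrite big1 // => i _; rewrite IH ?scaler0 //.
- by move=> q qs; apply: hs; rewrite inE qs orbT.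
- exact: lw_subst_graded.
- move=> [d j] qin qs; rewrite /lw_subst /=; case: eqP => [e|/eqP ne].
    by have := zb i; rewrite -e.
  by apply: (hb (d, j)); rewrite // inE negb_or ne.
Qed.

Variables (D : finType) (c : D -> {scalar L}).
Hypothesis c_inj : forall x : L, (forall i, c i x = 0) -> x = 0.
Variable T : {set tuples}.
Hypothesis eval_outside : forall x w,
  mlin_word k m w -> x \notin T -> lw_eval (tuple_subst x) w = 0.

(** The matrix [M] of coordinates of the values of a basis of the quotient at the tuples in [T] has
    independent rows, so it has at least as many columns as rows. *)
Lemma gr_codim2_le : (gr_codim2 L k m <= #|T| * #|D|)%N.
Proof.
have [v [vP vf _]] := gr_codim2P L k m.
move: (gr_codim2 L k m) v vP vf => n v vP vf.
pose X := [the finType of {x | x \in T} * D : Type].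
pose ev (x : X) f : F := c x.2 (fls_eval (tuple_subst (val x.1)) f).
pose M : 'M[F]_(n, #|X|) := \matrix_(i < n, j < #|X|) ev (enum_val j) (v i).
suff /eqP r : row_free M.
  have -> : (#|T| * #|D|)%N = #|X| by rewrite card_prod card_sig.
  by rewrite -r rank_leq_col.
rewrite -kermx_eq0; apply/rowV0P => a /sub_kermxP aM.
apply/rowP => i; rewrite mxE.
(* It remains to show that a combination killed by [M] is a graded identity: it vanishes on [T] by
   the choice of [a] and outside [T] because every word does. *)
apply: (vf (a 0)).
have [N [b [w [hw fE]]]] : mlin_space k m (\sum_i a 0 i *: v i).
  exact: mlin_space_sum.
have eval_f (u : bool -> nat -> L) : graded_subst u ->
    fls_eval u (\sum_i a 0 i *: v i) = \sum_l b l *: lw_eval u (w l).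
  move=> hu; rewrite fE.
  rewrite (fls_eval_sum _ _ hu); apply: eq_bigr => l _; by rewrite fls_eval_lw.
move=> u hu; rewrite eval_f //; apply: mlin_eval0 => // x.
have [xT|xT] := boolP (x \in T); last first.
  by apply: big1 => l _; rewrite eval_outside ?scaler0.
apply: c_inj => d; rewrite -eval_f; last exact: tuple_subst_graded.
rewrite fls_eval_sum; last exact: tuple_subst_graded.
have /rowP/(_ (enum_rank (Sub x xT, d) : 'I_#|X|)) := aM.
rewrite !mxE => aM0; rewrite -[RHS]aM0 linear_sum; apply: eq_bigr => l _.
by rewrite linearZ mxE enum_rankK.
Qed.
End MultilinearCodimension.

(** * Coordinates on b(t) and its dimension *)

Section BCoordinates.
Variables (F : fieldType) (t : nat).
Local Notation M := 'M[F]_t.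

(* A single t x t matrix stores both off-diagonal blocks: its upper triangle *)
(* (with the diagonal) is that of B, its strict lower triangle that of C.    *)
Definition b_sym_of (N : M) : M :=
  \matrix_(i, j) if (i <= j)%N then N i j else N j i.
Definition b_skew_of (N : M) : M :=
  \matrix_(i, j) if (j < i)%N then N i j else if (i < j)%N then - N j i else 0.
Definition b_mx (p : M * M) : 'M[F]_(t + t) :=
  block_mx p.1 (b_sym_of p.2) (b_skew_of p.2) (- p.1^T).

Fact b_mx_linear : linear b_mx.
Proof.
move=> a [A N] [A' N']; rewrite /b_mx scale_block_mx add_block_mx /=.
congr block_mx; apply/matrixP => i j; rewrite !mxE.
- by case: ifP.
- by case: ifP => // _; case: ifP => // _; ring.
- by ring.
Qed.
HB.instance Definition _ :=
  GRing.isLinear.Build F (M * M)%type 'M[F]_(t + t) *:%R b_mx b_mx_linear.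

Definition trace_fst (p : M * M) : F^o := \tr p.1.
Fact trace_fst_linear : linear trace_fst.
Proof. by move=> a p q; rewrite /trace_fst /= mxtraceD mxtraceZ. Qed.
HB.instance Definition _ :=
  GRing.isLinear.Build F (M * M)%type F^o *:%R trace_fst trace_fst_linear.

Lemma b_mx_in p : trace_fst p = 0 -> b_mx p \in b_space F t.
Proof.
move=> p0; apply/b_spaceP; exists p.1, (b_sym_of p.2), (b_skew_of p.2).
split=> //; apply/matrixP => i j; rewrite !mxE.
- by case: ltngtP => // /val_inj ->.
- by case: ltngtP; rewrite ?opprK ?oppr0.
Qed.

Lemma b_mx_inj : injective b_mx.
Proof.
move=> [A N] [A' N'] /eq_block_mx /= [-> /matrixP hB /matrixP hC _].
congr (_, _); apply/matrixP => i j.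
have := hB i j; have := hC i j; rewrite !mxE.
by case: leqP.
Qed.

Hypothesis F0 : [pchar F] =i pred0.

Lemma b_spaceE X : X \in b_space F t -> exists2 p, trace_fst p = 0 & X = b_mx p.
Proof.
move=> /b_spaceP[A [B [C [hB hC hA ->]]]].
exists (A, \matrix_(i, j) if (i <= j)%N then B i j else C i j) => //.
have symB i j : B j i = B i j by rewrite -[in LHS]hB mxE.
have skewC i j : C j i = - C i j.
  by move/matrixP/(_ i j): hC; rewrite !mxE.
(* Skew symmetry only gives 2 C_ii = 0; characteristic 0 allows division by 2. *)
have C0 i : C i i = 0.
  apply/eqP; have /eqP := skewC i i; rewrite -subr_eq0 opprK -mulr2n -mulr_natr.
  by rewrite mulf_eq0 ((pcharf0P F).1 F0) orbF.
rewrite /b_mx; congr block_mx; apply/matrixP => i j; rewrite !mxE.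
- by case: ltngtP.
- case: ltngtP => ij; rewrite -?skewC //.
  by rewrite (val_inj ij).
Qed.

(** The space is the injective image under [b_mx] of the kernel of the trace, a nonzero functional
    on a space of dimension 2t^2. *)
Lemma dim_b_space : (0 < t)%N -> (\dim (b_space F t)).+1 = (t ^ 2 + t ^ 2)%N.
Proof.
move=> t_gt0; pose K := lker (linfun trace_fst).
have -> : b_space F t = (linfun b_mx @: K)%VS.
  apply/vspaceP => X; apply/idP/memv_imgP => [/b_spaceE[p p0 ->]|[p]].
    by exists p; rewrite ?memv_ker lfunE //= p0.
  by rewrite memv_ker lfunE /= => /eqP p0 ->; rewrite lfunE b_mx_in.
rewrite limg_dim_eq; last first.
  apply/eqP; rewrite -subv0; apply/subvP => p; rewrite memv_cap !memv_ker !lfunE /=.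
  case/andP=> _ /eqP h; have -> : p = 0 by apply: b_mx_inj; rewrite h linear0.
  exact: mem0v.
have := limg_ker_dim (linfun trace_fst) fullv.
rewrite capfv -/K.
have -> : \dim (linfun trace_fst @: fullv) = 1%N.
  apply/eqP; rewrite eqn_leq; apply/andP; split.
    by rewrite (leq_trans (dimvS (subvf _))) // dimvf.
  rewrite lt0n dimv_eq0; apply/negP => /eqP h.
  pose i0 := Ordinal t_gt0.
  have : linfun trace_fst (delta_mx i0 i0, 0) \in (linfun trace_fst @: fullv)%VS.
    by rewrite memv_img ?memvf.
  rewrite h memv0 lfunE /= /trace_fst /mxtrace (bigD1 i0) //= mxE !eqxx.
  rewrite big1 => [|i /negPf ni].
    by rewrite addr0 oner_eq0.
  by rewrite mxE ni.
rewrite addn1 => ->; rewrite dimvf.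
by rewrite -[dim _]/(dim M + dim M)%N !dim_matrix.
Qed.

End BCoordinates.

(** * Homogeneous spanning families of b(t) and its Z-grading *)

Section BBasis.
Variables (F : fieldType) (F0 : [pchar F] =i pred0) (t : nat) (i0 : 'I_t).
Local Notation b := (lie_super_b F0 t).
Local Notation M := 'M[F]_t.
Local Notation pairs := ('I_t * 'I_t)%type.

(** Subtracting the matrix unit at [(i0, i0)] makes the diagonal matrix units traceless. The element
    at [(i0, i0)] becomes 0, which leaves t^2 - 1 spanning elements. *)
Definition b_even (x : pairs) : b := vsproj (b_space F t)
  (b_mx (delta_mx x.1 x.2 - (x.1 == x.2)%:R *: delta_mx i0 i0, 0)).
Definition b_odd (x : pairs) : b := vsproj (b_space F t) (b_mx (0, delta_mx x.1 x.2)).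

Lemma mxtrace_delta (i j : 'I_t) : \tr (delta_mx i j : M) = (i == j)%:R.
Proof.
rewrite /mxtrace (bigD1 i) //= big1 => [|k /negPf ki].
  by rewrite mxE eqxx addr0.
by rewrite mxE ki.
Qed.

Lemma val_b_even x :
  vsval (b_even x) = b_mx (delta_mx x.1 x.2 - (x.1 == x.2)%:R *: delta_mx i0 i0, 0).
Proof.
rewrite vsprojK // b_mx_in // /trace_fst /= raddfB /= mxtraceZ !mxtrace_delta.
by rewrite eqxx mulr1 subrr.
Qed.

Lemma val_b_odd x : vsval (b_odd x) = b_mx (0, delta_mx x.1 x.2).
Proof. by rewrite vsprojK // b_mx_in // /trace_fst /= mxtrace0. Qed.

Lemma b_even_homog x : b_even x \in homog false.
Proof.
apply/b_homogP; rewrite val_b_even /mx_part /b_mx /= block_mxKul block_mxKdr.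
by congr block_mx; apply/matrixP => i j; rewrite !mxE; do ?case: ifP; rewrite ?oppr0.
Qed.

Lemma b_odd_homog x : b_odd x \in homog true.
Proof.
apply/b_homogP; rewrite val_b_odd /mx_part /b_mx /= block_mxKur block_mxKdl.
by rewrite trmx0 oppr0.
Qed.

Lemma b_odd_span (x : b) :
  x \in homog true -> exists a : pairs -> F, x = \sum_i a i *: b_odd i.
Proof.
move=> /b_homogP; have [[A N] _ xE] := b_spaceE F0 (subvsP x).
rewrite xE /mx_part /b_mx => /eq_block_mx[/= A0 _ _ _]; subst A.
exists (fun p => N p.1 p.2); apply: subvs_inj.
rewrite linear_sum xE.
have -> : (0, N) = \sum_(p : pairs) N p.1 p.2 *: (0 : M, delta_mx p.1 p.2 : M).
  rewrite -(pair_bigA _ (fun i j => N i j *: (0 : M, delta_mx i j : M))) /=.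
  apply: injective_projections => /=; rewrite raddf_sum /=.
    rewrite big1 // => i _; rewrite raddf_sum /= big1 // => j _; exact: scaler0.
  rewrite [LHS]matrix_sum_delta; apply: eq_bigr => i _.
  by rewrite raddf_sum.
rewrite linear_sum; apply: eq_bigr => p _.
by rewrite !linearZ /= val_b_odd.
Qed.

Lemma b_even_span (x : b) : x \in homog false ->
  exists a : {p in predC1 (i0, i0)} -> F, x = \sum_i a i *: b_even (val i).
Proof.
move=> /b_homogP; have [[A N]] := b_spaceE F0 (subvsP x).
rewrite /trace_fst /= => trA xE.
rewrite xE /mx_part /b_mx => /eq_block_mx[/= _ hB hC _].
have {}xE : vsval x = b_mx (A, 0).
  rewrite xE /b_mx /= -hB -hC; congr block_mx;
  by apply/matrixP => i j; rewrite !mxE; do ?case: ifP; rewrite ?oppr0.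
exists (fun p => A (val p).1 (val p).2); apply: subvs_inj.
rewrite linear_sum xE.
pose G (p : pairs) := A p.1 p.2 *: vsval (b_even p).
rewrite (eq_bigr (fun i => G (val i))); last by move=> p _; rewrite linearZ.
rewrite -(big_sub (predC1 (i0, i0)) G).
(* The missing term at [(i0, i0)] is zero, so the sum may run over all pairs. *)
have -> : \sum_(p in predC1 (i0, i0)) G p = \sum_p G p.
  rewrite [RHS](bigD1 (i0, i0)) //= [G (i0, i0)](_ : _ = 0) ?add0r //.
  by rewrite /G val_b_even /= eqxx scale1r subrr [b_mx _]linear0 scaler0.
rewrite /G; under eq_bigr => p _ do rewrite val_b_even -linearZ.
rewrite -linear_sum; congr b_mx; apply: injective_projections => /=; last first.
  by rewrite raddf_sum /= big1 // => i _; rewrite scaler0.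
rewrite raddf_sum /=; under eq_bigr do rewrite scalerBr.
rewrite sumrB -(pair_bigA _ (fun i j => A i j *: delta_mx i j)) /=.
rewrite -matrix_sum_delta.
under [X in _ = _ - X]eq_bigr do rewrite scalerA.
rewrite -scaler_suml.
(* The corrections at [(i0, i0)] add up to the trace of [A], which is 0. *)
have -> : \sum_(p : pairs) A p.1 p.2 * (p.1 == p.2)%:R = \tr A.
  rewrite -(pair_bigA _ (fun i j => A i j * (i == j)%:R)) /=.
  apply: eq_bigr => i _; rewrite (bigD1 i) //= eqxx mulr1 big1 ?addr0 // => j.
  by rewrite eq_sym => /negPf ->; rewrite mulr0.
by rewrite trA scale0r subr0.
Qed.

(* The Z-grading of b(t), read off from the commutator with diag(1, 0): the   *)
(* blocks A, B and C have degrees 0, 1 and -1.                                *)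
Definition b_degree (r : int) (x : b) : Prop :=
  let H := block_mx 1%:M 0 0 0 in
  H *m vsval x - vsval x *m H = r%:~R *: vsval x.

Lemma b_degreeE r x : b_degree r x <->
  block_mx 0 (ursubmx (vsval x)) (- dlsubmx (vsval x)) 0 = r%:~R *: vsval x.
Proof.
rewrite /b_degree /= -[in X in X <-> _](submxK (vsval x)) !mulmx_block.
rewrite !(mul0mx, mulmx0, mul1mx, mulmx1, addr0, add0r).
by rewrite opp_block_mx add_block_mx !oppr0 subrr addr0 add0r addr0 submxK.
Qed.

(** The commutator with diag(1, 0) is a derivation of the matrix product, so xy and yx both have
    degree r + s, whatever the sign between them. *)
Lemma b_degree_brs r s d e x y : x \in homog d -> y \in homog e ->
  b_degree r x -> b_degree s y -> b_degree (r + s) (brs x y).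
Proof.
rewrite /b_degree; set H := block_mx _ _ _ _ => hx hy.
rewrite (b_brs_homogE hx hy).
move: (vsval x) (vsval y) => X Y hX hY.
have {}hX : H *m X = X *m H + r%:~R *: X by rewrite -hX addrC subrK.
have {}hY : H *m Y = Y *m H + s%:~R *: Y by rewrite -hY addrC subrK.
rewrite mulmxBr mulmxBl -!(scalemxAr, scalemxAl) !mulmxA hX hY.
rewrite !mulmxDl -!mulmxA hX hY !mulmxDr -!(scalemxAr, scalemxAl) !mulmxA rmorphD /=.
by apply/matrixP => i j; rewrite !mxE; ring.
Qed.

Lemma intr_char0_eq0 (r : int) : (r%:~R == 0 :> F) = (r == 0).
Proof.
case: r => n; first by rewrite -pmulrn ((pcharf0P F).1 F0).
by rewrite NegzE mulrNz !oppr_eq0 -pmulrn ((pcharf0P F).1 F0).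
Qed.

(** The blocks are eigenspaces for 0, 1 and -1, and in characteristic 0 the image of r in F differs
    from all three. *)
Lemma b_degree_large r x : 1 < `|r| -> b_degree r x -> x = 0.
Proof.
move=> hr /b_degreeE h; apply: subvs_inj; rewrite linear0.
move: h; rewrite -[in X in _ = X -> _](submxK (vsval x)) scale_block_mx.
case/eq_block_mx => h1 h2 h3 h4; rewrite -[LHS]submxK.
have eq0 (s : int) (X : M) : s != 0 -> s%:~R *: X = 0 -> X = 0.
  by rewrite -intr_char0_eq0 => s0 /eqP; rewrite scaler_eq0 (negPf s0) => /eqP.
rewrite (eq0 _ _ _ (esym h1)) ?(eq0 _ _ _ (esym h4)); try lia.
rewrite (eq0 (r - 1) (ursubmx _)); [|lia|]; last first.
  by rewrite rmorphB /= scalerBl -h2 scale1r subrr.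
rewrite (eq0 (r + 1) (dlsubmx _)); [|lia|]; last first.
  by rewrite rmorphD /= scalerDl -h3 scale1r addNr.
exact: block_mx0.
Qed.

Definition odd_degree (x : pairs) : int := if (x.1 <= x.2)%N then 1 else -1.

(** A matrix unit on or above the diagonal contributes nothing to the C block, and one strictly
    below contributes nothing to the B block. *)
Lemma b_odd_degree x : b_degree (odd_degree x) (b_odd x).
Proof.
apply/b_degreeE; rewrite val_b_odd /b_mx block_mxKur block_mxKdl scale_block_mx /=.
rewrite trmx0 oppr0 !scaler0; case: x => i j; rewrite /odd_degree /=.
case: leqP => ij; congr block_mx; apply/matrixP => k l; rewrite !mxE ?mul1r ?mulN1r //.
- have ndelta : (l < k)%N -> (k == i) && (l == j) = false.
    by move=> kl; apply/negP => /andP[/eqP ? /eqP ?]; subst; lia.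
  have ndelta' : (k < l)%N -> (l == i) && (k == j) = false.
    by move=> kl; apply/negP => /andP[/eqP ? /eqP ?]; subst; lia.
  by case: ltngtP => [/ndelta|/ndelta'|]; rewrite ?oppr0 // => ->; rewrite ?oppr0.
- have ndelta : (k <= l)%N -> (k == i) && (l == j) = false.
    by move=> kl; apply/negP => /andP[/eqP ? /eqP ?]; subst; lia.
  have ndelta' : (l <= k)%N -> (l == i) && (k == j) = false.
    by move=> kl; apply/negP => /andP[/eqP ? /eqP ?]; subst; lia.
  by case: leqP => [/ndelta|/ltnW/ndelta'] ->; rewrite oppr0.
Qed.

Lemma b_even_degree x : b_degree 0 (b_even x).
Proof.
apply/b_degreeE; rewrite val_b_even /b_mx block_mxKur block_mxKdl scale0r /=.
rewrite -[RHS]block_mx0; congr block_mx; apply/matrixP => i j;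
by rewrite !mxE; do ?case: ifP; rewrite ?oppr0.
Qed.

Lemma b_degree0 r : b_degree r 0.
Proof.
rewrite /b_degree [vsval 0](linear0 (vsval (U := b_space F t))).
by rewrite mulmx0 mul0mx scaler0 subrr.
Qed.

Lemma lw_eval_degree (g : bool -> nat -> int) (v : bool -> nat -> b) w :
  graded_subst v -> (forall d i, b_degree (g d i) (v d i)) ->
  b_degree (\sum_(p <- lw_letters w) g p.1 p.2) (lw_eval v w).
Proof.
move=> hv hg; elim: w => [d i|w1 h1 w2 h2] /=; first by rewrite big_seq1.
rewrite big_cat /=.
by apply: b_degree_brs (lw_eval_homog _ hv) (lw_eval_homog _ hv) h1 h2.
Qed.

End BBasis.

(** * Codimensions of b(t) in terms of balanced odd tuples *)

Section BCodimension.
Variables (F : fieldType) (F0 : [pchar F] =i pred0) (t : nat).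
Hypothesis t_gt0 : (0 < t)%N.
Local Notation b := (lie_super_b F0 t).
Local Notation pairs := ('I_t * 'I_t)%type.

Definition balanced (m : nat) : {set {ffun 'I_m -> pairs}} :=
  [set u : {ffun 'I_m -> pairs} | `|\sum_j odd_degree (u j)| <= 1].

(** The even arguments are free, with t^2 - 1 choices each, and have degree 0; a monomial at an
    unbalanced odd tuple has degree of absolute value above 1. *)
Lemma b_codim2_le k m :
  (gr_codim2 b k m <= (t ^ 2 - 1) ^ k * #|balanced m| * \dim {: b})%N.
Proof.
pose i0 := Ordinal t_gt0.
pose E0 := {p in predC1 (i0, i0)}.
pose e0 (p : E0) : b := b_even F0 i0 (val p).
pose T : {set {ffun 'I_k -> E0} * {ffun 'I_m -> pairs}} :=
  finset.setX [set: {ffun 'I_k -> E0}] (balanced m).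
have cardT : #|T| = ((t ^ 2 - 1) ^ k * #|balanced m|)%N.
  rewrite finset.cardsX cardsT card_ffun card_ord card_sig; congr (_ ^ _ * _)%N.
  by rewrite cardC1 card_prod !card_ord subn1 mulnn.
rewrite -cardT -[X in (_ <= _ * X)%N]card_ord.
apply: (@gr_codim2_le F b k m _ _ e0 (@b_odd F F0 t) _ _ _ _ _
  (fun i => coord (vbasis {: b}) i) _ T).
- by move=> i; apply: b_even_homog.
- exact: b_odd_homog.
- exact: b_even_span.
- exact: b_odd_span.
- move=> x x0; rewrite (coord_vbasis (memvf x)) big1 // => i _.
  by rewrite x0 scale0r.
move=> [s u] w hw; rewrite finset.in_setX inE /= inE -ltNge => hu.
(* Variables out of range take the value 0, which has every degree, so the default degree 0 is
   correct for them. *)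
pose g (d : bool) (i : nat) : int :=
  if d then oapp (fun j => odd_degree (u j)) 0 (insub i) else 0.
apply: (b_degree_large (r := \sum_(p <- lw_letters w) g p.1 p.2)).
  rewrite (perm_big _ hw) big_cat !big_map /= big1_eq add0r.
  rewrite -[X in iota 0 X]subn0 big_mkord.
  by rewrite (eq_bigr (fun j => odd_degree (u j))) // => j _; rewrite /g valK.
apply: lw_eval_degree.
  apply: tuple_subst_graded; last exact: b_odd_homog.
  by move=> i; apply: b_even_homog.
move=> [] i; rewrite /g /tuple_subst /=; case: insub => [j|] /=.
- exact: b_odd_degree.
- exact: b_degree0.
- exact: b_even_degree.
- exact: b_degree0.
Qed.

Lemma dim_b : (\dim {: b}).+1 = (2 * t ^ 2)%N.
Proof.
have <- : \dim (b_space F t) = \dim {: b} by rewrite dimvf.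
by rewrite dim_b_space // addnn mul2n.
Qed.

End BCodimension.

(** * Weighted count of balanced tuples *)

Section BalancedCount.
Variables (R : realType) (t : nat).
Hypothesis t_ge2 : (2 <= t)%N.
Local Notation pairs := ('I_t * 'I_t)%type.
Local Notation r := (Num.sqrt (t%:R ^+ 2 - 1) : R).

(* The weight w is sqrt(q/p): then p w = q / w = t r / 2.                     *)
Local Notation w := (r / (t%:R + 1)).

Let t_ge2R : 2 <= t%:R :> R. Proof. by rewrite ler_nat. Qed.
Let r_gt0 : 0 < r. Proof. by rewrite sqrtr_gt0; have := t_ge2R; nra. Qed.
Let rr : r * r = t%:R ^+ 2 - 1.
Proof. by rewrite -expr2 sqr_sqrtr //; have := t_ge2R; nra. Qed.
Let w_gt0 : 0 < w. Proof. by rewrite divr_gt0 // ltr_wpDl. Qed.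
Let w_le1 : w <= 1.
Proof.
have := t_ge2R; have := r_gt0; have := rr => h1 h2 h3.
rewrite ler_pdivrMr; last by lra.
by rewrite mul1r; nra.
Qed.

Lemma sum_weight : \sum_(x : pairs) w ^ odd_degree x = t%:R * r.
Proof.
have wV : w^-1 = r / (t%:R - 1).
  have := t_ge2R; have := r_gt0; have := rr => h1 h2 h3.
  apply/eqP; rewrite invf_div eqr_div ?lt0r_neq0 //; last by lra.
  by apply/eqP; rewrite rr; ring.
transitivity (\sum_(i < t) \sum_(j < t) w ^ (if (i <= j)%N then 1 else -1 : int)).
  by rewrite pair_bigA.
set S := (LHS).
(* Adding the transposed sum avoids counting the triangles: positions (i, j) and (j, i) have weights
   w and 1/w off the diagonal, and both are w on it. *)
have SE : S + S = \sum_(i < t) \sum_(j < t) (w + w^-1 + (w - w^-1) *+ (i == j)).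
  rewrite {2}/S exchange_big -big_split; apply: eq_bigr => i _.
  rewrite -big_split; apply: eq_bigr => j _ /=.
  by rewrite -val_eqE /=; case: ltngtP => _;
    rewrite ?expr1z ?exprN1 ?mulr1n ?mulr0n /=; ring.
suff SS : S + S = t%:R * r + t%:R * r by lra.
rewrite SE (eq_bigr (fun=> (w + w^-1) *+ t + (w - w^-1))) => [|i _]; last first.
  rewrite big_split /= sumr_const card_ord (bigD1 i) //= eqxx big1 ?addr0 // => j.
  by rewrite eq_sym => /negPf ->.
rewrite sumr_const card_ord wV -[LHS]mulr_natr -[in LHS](mulr_natr (_ + _)).
move: t_ge2R; move: (t%:R : R) (r) => y z y2.
by field; apply/andP; split; apply: lt0r_neq0; lra.
Qed.

(** Expanding the m-th power of [sum_weight] gives the total weight of all tuples. Weights are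
    nonnegative, and since w <= 1 a balanced tuple weighs 1/w, 1 or w, hence at least w. *)
Lemma card_balanced m : #|balanced t m|%:R <= w^-1 * (t%:R * r) ^+ m.
Proof.
rewrite ler_pdivlMl // -sum_weight.
have -> : (\sum_(x : pairs) w ^ odd_degree x) ^+ m =
    \sum_(u : {ffun 'I_m -> pairs}) w ^ (\sum_j odd_degree (u j)).
  rewrite -[in LHS](card_ord m) -prodr_const bigA_distr_bigA.
  have wD : {morph exprz w : x y / x + y >-> x * y}.
    by move=> x y; rewrite expfzDr // gt_eqF.
  by apply: eq_bigr => u _; rewrite (big_morph _ wD (expr0z w)).
rewrite -[#|_|%:R]sumr_const mulr_sumr [leRHS](bigID (mem (balanced t m))) /=.
rewrite -[leLHS]addr0 lerD //; last by apply: sumr_ge0 => u _; rewrite exprz_ge0 // ltW.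
apply: ler_sum => u; rewrite inE mulr1; set z := \sum_j _ => hz.
have [-> //|[->|->]] : z = 1 \/ z = 0 \/ z = -1 by lia.
  by rewrite expr0z.
by rewrite exprN1 (le_trans w_le1) // invf_ge1.
Qed.

End BalancedCount.

(** * Upper limits of n-th roots and conclusion *)

Lemma bernoulli_ge (R : realDomainType) (x : R) n : 0 <= x -> 1 + x *+ n <= (1 + x) ^+ n.
Proof.
move=> x0; elim: n => [|n IH]; first by rewrite mulr0n addr0.
rewrite exprS; apply: (@le_trans _ _ ((1 + x) * (1 + x *+ n))).
  have : 0 <= x * (x *+ n) by rewrite mulr_ge0 // mulrn_wge0.
  by rewrite mulrDl mul1r mulrDr mulr1 mulrS; lra.
by rewrite ler_wpM2l // addr_ge0.
Qed.

(** For e > 0 the constant K is eventually absorbed: K <= (1 + e/a)^n by Bernoulli's inequality, so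
    u n <= (a + e)^n from some rank on. *)
Lemma limn_esup_root_le (R : realType) (u : nat -> R) (K a : R) :
    0 < K -> 0 < a -> (forall n, 0 <= u n) ->
    (forall n, (0 < n)%N -> u n <= K * a ^+ n) ->
  (limn_esup (fun n => (u n `^ (n%:R^-1))%:E) <= a%:E)%E.
Proof.
move=> K0 a0 u0 hu; apply/lee_addgt0Pr => e e0.
pose d := e / a; have d0 : 0 < d by rewrite divr_gt0.
pose N := (Num.bound (K / d)).+1.
apply: ge_ereal_inf.
exists (ereal_sup [set (u n `^ (n%:R^-1))%:E | n in [set n | (N <= n)%N]])%classic.
  by exists [set n | (N <= n)%N]%classic => //; exists N.
apply: ge_ereal_sup => _ [n /= Nn <-]; rewrite -EFinD lee_fin.
have n0 : (0 < n)%N by apply: leq_trans Nn.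
have Kn : K <= (1 + d) ^+ n.
  apply: le_trans (bernoulli_ge n (ltW d0)).
  have : K / d < n%:R.
    apply: lt_le_trans (archi_boundP _) _; first by rewrite divr_ge0 ?ltW.
    by rewrite ler_nat (leq_trans _ Nn).
  by rewrite ltr_pdivrMr // -mulr_natr mulrC; lra.
have ae0 : 0 <= a + e by rewrite addr_ge0 ?ltW.
have un : u n <= (a + e) ^+ n.
  apply: le_trans (hu n n0) _.
  have -> : a + e = (1 + d) * a by rewrite mulrDl mul1r divfK ?gt_eqF.
  by rewrite exprMn ler_wpM2r // exprn_ge0 // ltW.
have -> : a + e = ((a + e) ^+ n) `^ (n%:R^-1).
  by rewrite -powR_mulrn // -powRrM mulfV ?pnatr_eq0 -?lt0n // powRr1.
by apply: ge0_ler_powR; rewrite ?nnegrE ?invr_ge0 // exprn_ge0.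
Qed.

Theorem theorem1 (R : realType) (F : fieldType) (charF0 : [pchar F] =i pred0)
    (t : nat) (t_ge2 : (2 <= t)%N) :
  (exists h : {poly R}, forall n : nat, (1 <= n)%N ->
     (gr_codim (lie_super_b charF0 t) n)%:R <=
       h.[n%:R] * (t%:R ^+ 2 - 1 + t%:R * Num.sqrt (t%:R ^+ 2 - 1)) ^+ n) /\
  (upper_gr_exp R (lie_super_b charF0 t) <=
     (t%:R ^+ 2 - 1 + t%:R * Num.sqrt (t%:R ^+ 2 - 1))%:E)%E /\
  t%:R ^+ 2 - 1 + t%:R * Num.sqrt (t%:R ^+ 2 - 1) < 2 * t%:R ^+ 2 - 1 :> R /\
  2 * t%:R ^+ 2 - 1 = (\dim {: lie_super_b charF0 t})%:R :> R.
Proof.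
set b := lie_super_b charF0 t.
set r : R := Num.sqrt (t%:R ^+ 2 - 1); set a := _ + t%:R * r.
have t_gt0 : (0 < t)%N by apply: ltnW.
have t2 : 2 <= t%:R :> R by rewrite ler_nat.
have r_gt0 : 0 < r by rewrite sqrtr_gt0; nra.
have rr : r * r = t%:R ^+ 2 - 1 by rewrite -expr2 sqr_sqrtr //; nra.
have a_gt0 : 0 < a by rewrite /a; nra.
pose K : R := (\dim {: b})%:R * (r / (t%:R + 1))^-1.
have dimE : 2 * t%:R ^+ 2 - 1 = (\dim {: b})%:R :> R.
  by rewrite -natrX -natrM -(dim_b charF0 t_gt0) -natr1 addrK.
have K_gt0 : 0 < K.
  rewrite /K -dimE mulr_gt0 ?invr_gt0 ?divr_gt0 //; nra.
(* The sum over k is compared term by term with the binomial expansion of a^n; [K] collects dim L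
   and the factor 1/w = sqrt(p/q) of [card_balanced]. *)
have bound n : (gr_codim b n)%:R <= K * a ^+ n.
  rewrite natr_sum /a addrC exprDn mulr_sumr; apply: ler_sum => k _.
  rewrite natrM -[in leRHS]mulr_natl [leRHS]mulrCA ler_wpM2l //.
  have := b_codim2_le charF0 t_gt0 k (n - k); rewrite -(ler_nat R) => /le_trans; apply.
  rewrite !natrM natrX natrB ?expn_gt0 ?t_gt0 // natrX.
  have := card_balanced R t_ge2 (n - k); rewrite -/r => hbal.
  rewrite /K; set d := _ ^+ 2 - 1; rewrite [leRHS](_ : _ =
    d ^+ k * ((r / (t%:R + 1))^-1 * (t%:R * r) ^+ (n - k)) * (\dim {: b})%:R).
    by rewrite ler_wpM2r // ler_wpM2l // exprn_ge0 // /d; nra.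
  by ring.
split; first by exists K%:P => n _; rewrite hornerC.
split; first exact: (limn_esup_root_le K_gt0 a_gt0).
(* The strict inequality amounts to r < t, which follows from r^2 = t^2 - 1. *)
by split=> //; rewrite /a; nra.
Qed.
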